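(* Let $V$ be a finite-dimensional real inner product space, let $k\ge 1$, and let $h\in J^k$ be a $k$-jet, regarded as a polynomial map germ $V,0\to V$ of degree at most $k$ with $h(0)=0$. Let $L=(dh)_0$, let $L^t$ be the adjoint of $L$, let $\mathbf{S}=\overline{\{e^{sL^t} : s\in\mathbb{R}\}}$, and let $\vec{\mathcal{P}}_V^{k+1}(\mathbf{S})$ be the vector subspace of $\vec{\mathcal{P}}_V^{k+1}$ of $\mathbf{S}$-equivariant elements. Then $$ \mathcal{M}^{k+1}\vec{\mathcal{E}}_V \subset \vec{\mathcal{P}}_V^{k+1}(\mathbf{S}) + T\mathcal{G}\cdot h + \mathcal{M}^{k+2}\vec{\mathcal{E}}_V . $$
   Context: $\mathcal{E}_V$ is the ring of $C^\infty$ function germs $V,0\to\mathbb{R}$. Its maximal ideal is $\mathcal{M}=\{f\in\mathcal{E}_V : f(0)=0\}$, and $\mathcal{M}^j$ denotes its $j$-th power. $\vec{\mathcal{E}}_V$ is the $\mathcal{E}_V$-module of $C^\infty$ map germs defined at $0\in V$ with values in $V$. Thus $\mathcal{M}^{j}\vec{\mathcal{E}}_V$ consists of the germs whose Taylor expansion at $0$ has no terms of degree less than $j$. $J^k$ is the space of $k$-jets at $0$ of elements of $\mathcal{M}\vec{\mathcal{E}}_V$, so $J^k\cong \mathcal{M}\vec{\mathcal{E}}_V/\mathcal{M}^{k+1}\vec{\mathcal{E}}_V$. Each $k$-jet is identified with its Taylor polynomial of degree at most $k$. $\vec{\mathcal{P}}_V^{l}$ is the space of homogeneous polynomial maps $V\to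 V$ of degree $l$. The closure in $\mathbf{S}=\overline{\{e^{sL^t} : s\in\mathbb{R}\}}$ is taken in $\mathrm{GL}(V)$, and $\mathbf{S}$ acts linearly on $V$. Then $\vec{\mathcal{P}}_V^{l}(\mathbf{S})=\{p\in\vec{\mathcal{P}}_V^{l} : p(Ax)=A\,p(x)\ \text{for all } A\in\mathbf{S},\ x\in V\}$. $\mathcal{G}$ consists of the diffeomorphism germs $\xi:V,0\to V$ of the form $\xi=I+\tilde\xi$, where $I$ is the identity germ and $\tilde\xi\in\bigoplus_{l\ge 2}\vec{\mathcal{P}}_V^l$. It acts on $\mathcal{M}\vec{\mathcal{E}}_V$ by changes of coordinates of vector fields: $(\xi\cdot h)(x)=\big((d\xi)_x\big)^{-1}h(\xi(x))$. The tangent space $T\mathcal{G}\cdot h$ to the orbit of $h$ is the set of all germs $x\mapsto \frac{d}{dt}\phi(x,t)\big|_{t=0}$, where $\phi(x,t)=\big((d\xi(\cdot,t))_x\big)^{-1}h(\xi(x,t))$ and $\xi(\cdot,t)$ ranges over the smooth one-parameter families in $\mathcal{G}$ with $\xi(x,0)=x$. Sums of subsets of $\vec{\mathcal{E}}_V$ are elementwise sums. *)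

(* Defs.v *)
From HB Require Import structures.
From mathcomp Require Import all_boot all_order all_algebra sesquilinear.
From mathcomp Require Import all_classical all_reals all_analysis.

Set Implicit Arguments.
Unset Strict Implicit.
Unset Printing Implicit Defensive.

Import Order.TTheory GRing.Theory Num.Theory.
Import numFieldNormedType.Exports.

Local Open Scope classical_set_scope.
Local Open Scope ring_scope.

(* A germ at 0 is represented by any total function that induces it. The sets
   of germs [smooth_germs], [max_ideal], [Mpow] and [tangent_orbit] are
   invariant under changing a function outside a neighbourhood of 0, while
   polynomial maps and elements of [diffeos] are represented by the polynomials
   themselves. A [sumset] with a summand [Mpow] is therefore again invariant, and
   it represents the elementwise sum of germs. *)

Section Smoothness.
Variable R : realType.

(* C^n on the open set A, for finite-dimensional U: continuity in x of the
   differential is then the same as continuity of each ['d f x v]. *)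
Fixpoint Cn_on (U W : normedModType R) (n : nat) (A : set U) (f : U -> W) :
    Prop :=
  match n with
  | 0 => forall x, A x -> {for x, continuous f}
  | n'.+1 => (forall x, A x -> differentiable f x) /\
             (forall v : U, Cn_on n' A (fun x => 'd f x v : W))
  end.

Definition smooth_near (U W : normedModType R) (a : U) (f : U -> W) : Prop :=
  exists A : set U, open_nbhs a A /\ forall n, Cn_on n A f.

Definition finite_dimensional (V : lmodType R) : Prop :=
  exists (n : nat) (e : 'I_n -> V),
    forall v : V, exists c : 'I_n -> R, v = \sum_(i < n) c i *: e i.

End Smoothness.

Section Germs.
Variables (R : realType) (V : normedModType R).

Definition smooth_germs (W : normedModType R) : set (V -> W) :=
  [set f | smooth_near 0 f].

Definition max_ideal : set (V -> R^o) :=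
  [set f | smooth_germs f /\ f 0 = 0].

(* The submodule (max_ideal ^ j) * smooth_germs V of smooth_germs V: finite sums
   of germs a_1 ... a_j g with all a_l in the ideal. *)
Definition Mpow (j : nat) : set (V -> V) :=
  [set f | exists (m : nat) (a : 'I_m -> 'I_j -> (V -> R^o)) (g : 'I_m -> (V -> V)),
    [/\ forall i l, max_ideal (a i l),
        forall i, smooth_germs (g i) &
        \forall x \near (0 : V),
          f x = \sum_(i < m) (\prod_(l < j) (a i l x : R)) *: g i x]].

(* Homogeneous polynomial maps of degree l, as elements of Sym^l(V^* ) (x) V:
   finite sums of products of l linear forms times a fixed vector. *)
Definition homog (l : nat) : set (V -> V) :=
  [set p | exists (m : nat) (a : 'I_m -> 'I_l -> {scalar V}) (v : 'I_m -> V),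
    p = (fun x => \sum_(i < m) (\prod_(j < l) a i j x) *: v i)].

(* k-jets of germs vanishing at 0, identified with Taylor polynomials. *)
Definition jets (k : nat) : set (V -> V) :=
  [set h | exists q : nat -> V -> V, (forall l, homog l (q l)) /\
    h = (fun x => \sum_(1 <= l < k.+1) q l x)].

Definition is_adjoint (ip : {dot V for idfun}) (L Lt : V -> V) : Prop :=
  forall x y, ip (L x) y = ip x (Lt y).

Definition expop (A : V -> V) (x : V) : V :=
  limn (series (fun n => (n`!%:R : R)^-1 *: iter n A x)).

(* Closure in GL(V), for the operator norm, of {exp(s N) | s real}. *)
Definition exp_closure (N : V -> V) : set {linear V -> V} :=
  [set A | bijective A /\
    forall e : R, 0 < e -> exists s : R,
      forall x, `|expop (fun y => s *: N y) x - A x| <= e * `|x|].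

Definition homog_equivariant (l : nat) (S : set {linear V -> V}) :
    set (V -> V) :=
  [set p | homog l p /\ forall A : {linear V -> V}, S A -> forall x, p (A x) = A (p x)].

(* xi = I + (polynomial with no terms of degree < 2); since (d xi)_0 = I, such a
   map is automatically a diffeomorphism germ at 0. *)
Definition diffeos : set (V -> V) :=
  [set xi | exists (d : nat) (q : nat -> V -> V), (forall l, homog l (q l)) /\
    xi = (fun x => x + \sum_(2 <= l < d) q l x)].

(* The value at y of the inverse of A; meaningful when A is bijective. *)
Definition inv_at (A : V -> V) (y : V) : V := get [set x | A x = y].

Definition change_coord (xi h : V -> V) (x : V) : V :=
  inv_at ('d xi x) (h (xi x)).

Definition smooth_family (xi : R -> V -> V) : Prop :=
  [/\ \forall t \near (0 : R), diffeos (xi t),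
      smooth_near (0 : (V * R^o)%type) (fun p => xi p.2 p.1) &
      forall x, xi 0 x = x].

Definition tangent_orbit (h : V -> V) : set (V -> V) :=
  [set g | exists xi : R -> V -> V, smooth_family xi /\
    \forall x \near (0 : V),
      is_derive (0 : R^o) (1 : R^o) (fun t : R^o => change_coord (xi t) h x) (g x)].

Definition sumset (A B : set (V -> V)) : set (V -> V) :=
  [set f \+ g | f in A & g in B].

End Germs.

Arguments Mpow {R} V j.

(* Main.v *)
(** Write ad_A q for x |-> dq_x (A x) - A (q x). On tensors of coefficients in
    orthonormal coordinates ad_A acts by a matrix whose transpose is the matrix
    of ad_{A^t}; hence every homogeneous p of degree k+1 is ad_L q + s with
    ad_{L^t} s = 0. The second condition says that s o e^{tL^t} and e^{tL^t} o s
    solve the same linear equation, so that s is equivariant. The family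
    x + t q(x) has the tangent vector dh_x q(x) - dq_x h(x), which agrees with
    - ad_L q modulo terms of degree k+2. Hadamard's lemma a(x) = sum x_i b_i(x),
    with b_i(x) = int_0^1 (d a)_{sx} e_i ds smooth, reduces a germ in M^{k+1} to
    its leading homogeneous part p and puts the remainders in M^{k+2}. *)

Require Import Defs.
From HB Require Import structures.
From mathcomp Require Import all_boot all_order all_algebra sesquilinear.
From mathcomp Require Import all_classical all_reals all_analysis.
From mathcomp Require Import lra.
Import Order.TTheory GRing.Theory Num.Theory.
Import numFieldNormedType.Exports.
Local Open Scope classical_set_scope.
Local Open Scope ring_scope.

Set Implicit Arguments.
Unset Strict Implicit.
Unset Printing Implicit Defensive.

(** * Differentials and maps of class C^n *)

(** The splitting asks for an inner product that makes ad_{L^t} the adjoint of ad_L. On polynomials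
    such a product (Fischer's) carries factorial weights. On tensors the factors keep their
    positions, all coordinate monomials can be given length one, and the adjoint is a plain
    transpose. The price is that coefficients are no longer unique; only the existence of a
    decomposition passes from tensors to polynomials, and that is all the inclusion asks for.

    Orthonormal coordinates serve the analysis as well. The norm is the Euclidean one, so each
    coordinate is bounded by it and every linear map out of V is continuous. Exponentials, integrals
    and inverses are treated through scalar coordinates or one vector at a time, never as curves in
    a space of operators. *)

Section Differentials.
Variable R : realType.

Lemma diff_eps (U W : normedModType R) (f : U -> W) (df : {linear U -> W}) x :
  continuous df ->
  (forall e : R, 0 < e -> \forall u \near (0 : U),
    `|f (x + u) - f x - df u| <= e * `|u|) ->
  differentiable f x /\ 'd f x = df :> (U -> W).
Proof.
move=> cdf H.
have E : f \o shift x = cst (f x) + df +o_ 0 id.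
  apply/eqaddoP => e e0; near=> u.
  change (`|f (u + x) - (f x + df u)| <= e * `|u|).
  rewrite opprD addrA (addrC u x).
  by near: u; exact: H.
have D : 'd f x = df :> (U -> W) by exact: diff_unique.
by split => //; apply/diff_locallyP; rewrite D.
Unshelve. all: by end_near. Qed.

Lemma diff_epsP (U W : normedModType R) (f : U -> W) x : differentiable f x ->
  forall eps : R, 0 < eps -> \forall u \near (0 : U),
    `|f (x + u) - f x - 'd f x u| <= eps * `|u|.
Proof.
move=> df eps eps0; have [dc /eqaddoP dE] := (diff_locallyP x f).1 df.
near=> u; have : `|f (u + x) - (f x + 'd f x u)| <= eps * `|u|.
  by near: u; exact: dE.
by rewrite opprD addrA (addrC u x).
Unshelve. all: by end_near. Qed.

Lemma near_eq_diff (U W : normedModType R) (f g : U -> W) x :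
  (\forall y \near x, f y = g y) -> differentiable f x ->
  differentiable g x /\ 'd g x = 'd f x :> (U -> W).
Proof.
move=> fg df; have dE := diff_epsP df.
apply: diff_eps => [|eps eps0]; first exact: diff_continuous.
have fg0 : \forall u \near (0 : U), f (x + u) = g (x + u).
  have c0 : (fun u : U => x + u) @ (0 : U) --> x.
    rewrite -[X in _ --> X]addr0; apply: cvgD; [exact: cvg_cst|exact: cvg_id].
  exact: (c0 _ fg).
near=> u; have <- : f (x + u) = g (x + u) by near: u.
by rewrite -(nbhs_singleton fg); near: u; exact: dE.
Unshelve. all: by end_near. Qed.

(** Scaling receives a bilinear structure so that the product rule [diff_scale] becomes the chain
    rule for a bilinear map composed with a pair. *)
Definition scalev (W : normedModType R) (a : R^o) (w : W) : W := a *: w.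

Lemma scalev_bilinear (W : normedModType R) :
  bilinear_for (GRing.Scale.Law.clone _ _ *:%R _)
    (GRing.Scale.Law.clone _ _ *:%R _) (@scalev W).
Proof.
split=> [u'|u] a x y; rewrite /scalev /=.
- by rewrite scalerDl scalerA.
- by rewrite scalerDr !scalerA mulrC.
Qed.

HB.instance Definition _ (W : normedModType R) :=
  bilinear_isBilinear.Build R R^o W W _ _ (@scalev W) (@scalev_bilinear W).

Lemma diff_scale (U W : normedModType R) (f : U -> R^o) (g : U -> W) x :
  differentiable f x -> differentiable g x ->
  differentiable (fun y => f y *: g y) x /\
  'd (fun y => f y *: g y) x = (fun v => 'd f x v *: g x + f x *: 'd g x v)
    :> (U -> W).
Proof.
move=> df dg.
have cs : continuous (fun p : R^o * W => scalev p.1 p.2).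
  by move=> p; apply: scale_continuous.
have dp := differentiable_pair df dg.
have db := @differentiable_bilin R R^o W W (@scalev W) (f x, g x) cs.
split.
  exact: (differentiable_comp (g := fun p : R^o * W => scalev p.1 p.2) dp db).
have -> : (fun y => f y *: g y) =
  (fun p : R^o * W => scalev p.1 p.2) \o (fun y => (f y, g y)) by [].
rewrite diff_comp//= diff_pair//; apply/funext => v /=.
have /= -> := congr1 (fun F => F ('d f x v, 'd g x v))
  (@diff_bilin R R^o W W (@scalev W) (f x, g x) cs).
by rewrite /scalev addrC.
Qed.

End Differentials.

Section CnCalculus.
Variables (R : realType) (U : normedModType R) (A : set U).
Hypothesis Aopen : open A.

(** A differential depends on values near a point: openness of [A] turns agreement on [A] into
    agreement near each of its points, and the differentials inherit it. *)
Lemma Cn_congr (W : normedModType R) n (f g : U -> W) :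
  (forall x, A x -> f x = g x) -> Cn_on n A f -> Cn_on n A g.
Proof.
have nA x : A x -> \forall y \near x, A y by move=> Ax; exact: open_nbhs_nbhs.
elim: n f g => [|n IH] f g fg.
  move=> /= H x Ax; suff : g @ x --> g x by [].
  rewrite -(fg x Ax).
  apply: cvg_trans (H x Ax); apply: near_eq_cvg.
  by apply: filterS (nA x Ax) => y /fg.
have fgn x : A x -> \forall y \near x, f y = g y.
  by move=> /nA; apply: filterS => y /fg.
move=> /= [df Cf]; split=> [x Ax|v].
  by have [] := near_eq_diff (fgn x Ax) (df x Ax).
apply: IH (Cf v) => x Ax.
by have [_ ->] := near_eq_diff (fgn x Ax) (df x Ax).
Qed.

Lemma Cn_onS (W : normedModType R) n (f : U -> W) :
  Cn_on n.+1 A f -> Cn_on n A f.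
Proof.
elim: n f => [|n IH] f; first by move=> [df _] x /df/differentiable_continuous.
by move=> [df Cf]; split=> // v; apply: IH; exact: Cf.
Qed.

Lemma Cn_on_cst (W : normedModType R) n (c : W) : Cn_on n A (fun=> c).
Proof.
elim: n c => [|n IH] c; first by move=> x _; exact: cvg_cst.
split=> [x _|v]; first exact: differentiable_cst.
by apply: Cn_congr (IH 0) => x _; rewrite (diff_cst c).
Qed.

Lemma Cn_on_lin (W : normedModType R) n (f : {linear U -> W}) :
  continuous f -> Cn_on n A f.
Proof.
move=> cf; case: n => [|n]; first by move=> x _; exact: cf.
split=> [x _|v]; first exact: linear_differentiable.
by apply: Cn_congr (Cn_on_cst n (f v)) => x _; rewrite diff_lin.
Qed.

Lemma Cn_onD (W : normedModType R) n (f g : U -> W) :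
  Cn_on n A f -> Cn_on n A g -> Cn_on n A (fun x => f x + g x).
Proof.
elim: n f g => [|n IH] f g /=.
  by move=> cf cg x Ax; apply: cvgD; [exact: cf|exact: cg].
move=> [df Cf] [dg Cg]; split=> [x Ax|v].
  by apply: (differentiableD (f := f) (g := g)); [exact: df|exact: dg].
apply: Cn_congr (IH _ _ (Cf v) (Cg v)) => x Ax.
have -> : (fun y => f y + g y) = f + g by [].
by rewrite diffD//; [exact: df|exact: dg].
Qed.

Lemma Cn_onZ (W : normedModType R) n (f : U -> R^o) (g : U -> W) :
  Cn_on n A f -> Cn_on n A g -> Cn_on n A (fun x => f x *: g x).
Proof.
elim: n f g => [|n IH] f g.
  by move=> cf cg x Ax; apply: cvgZ; [exact: cf|exact: cg].
(* Each Leibniz term pairs a derivative with an underived factor, which enters the induction in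
   class n. *)
move=> Cf Cg; have Cf' := Cn_onS Cf; have Cg' := Cn_onS Cg.
case: Cf Cg => [df Cf] [dg Cg]; split=> [x Ax|v].
  by have [] := diff_scale (df x Ax) (dg x Ax).
apply: Cn_congr (Cn_onD (IH _ _ (Cf v) Cg') (IH _ _ Cf' (Cg v))) => x Ax.
by have [_ ->] := diff_scale (df x Ax) (dg x Ax).
Qed.

End CnCalculus.

Section SmoothNear.
Variables (R : realType) (U : normedModType R) (a : U).

Lemma Cn_subset (W : normedModType R) n (A B : set U) (f : U -> W) :
  B `<=` A -> Cn_on n A f -> Cn_on n B f.
Proof.
move=> BA; elim: n f => [|n IH] f /=; first by move=> H x /BA/H.
by move=> [df Cf]; split=> [x /BA/df//|v]; exact: IH.
Qed.

Lemma smooth_near2 (W1 W2 W : normedModType R) (f : U -> W1) (g : U -> W2)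
    (h : U -> W) :
  (forall A n, open A -> Cn_on n A f -> Cn_on n A g -> Cn_on n A h) ->
  smooth_near a f -> smooth_near a g -> smooth_near a h.
Proof.
move=> H [A [[Ao Aa] Cf]] [B [[Bo Ba] Cg]]; exists (A `&` B); split.
  by split; [exact: openI|split].
by move=> n; apply: H; [exact: openI|apply: Cn_subset (Cf n)|apply: Cn_subset (Cg n)];
  move=> x [].
Qed.

Lemma smooth_nearD (W : normedModType R) (f g : U -> W) :
  smooth_near a f -> smooth_near a g -> smooth_near a (fun x => f x + g x).
Proof. by apply: smooth_near2 => A n Ao; exact: Cn_onD. Qed.

Lemma smooth_nearZ (W : normedModType R) (f : U -> R^o) (g : U -> W) :
  smooth_near a f -> smooth_near a g -> smooth_near a (fun x => f x *: g x).
Proof. by apply: smooth_near2 => A n Ao; exact: Cn_onZ. Qed.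

Lemma smooth_near_cst (W : normedModType R) (c : W) : smooth_near a (fun=> c).
Proof.
exists setT; split; first exact: open_nbhsT.
by move=> n; apply: Cn_on_cst; exact: openT.
Qed.

Lemma smooth_near_lin (W : normedModType R) (f : {linear U -> W}) :
  continuous f -> smooth_near a f.
Proof.
move=> cf; exists setT; split; first exact: open_nbhsT.
by move=> n; apply: Cn_on_lin => //; exact: openT.
Qed.

Lemma smooth_near_ext (W : normedModType R) (f g : U -> W) :
  f =1 g -> smooth_near a f -> smooth_near a g.
Proof. by move=> /funext ->. Qed.

Lemma smooth_near_sum (W : normedModType R) (I : Type) (s : seq I) (P : pred I)
    (f : I -> U -> W) :
  (forall i, P i -> smooth_near a (f i)) ->
  smooth_near a (fun x => \sum_(i <- s | P i) f i x).
Proof.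
move=> H; elim: s => [|i s IH].
  by apply: smooth_near_ext (smooth_near_cst 0) => x; rewrite big_nil.
case Pi : (P i); last by apply: smooth_near_ext IH => x; rewrite big_cons Pi.
by apply: smooth_near_ext (smooth_nearD (H i Pi) IH) => x; rewrite big_cons Pi.
Qed.

Lemma smooth_near_prod (I : Type) (s : seq I) (P : pred I) (f : I -> U -> R^o) :
  (forall i, P i -> smooth_near a (f i)) ->
  smooth_near a (fun x => (\prod_(i <- s | P i) (f i x : R)) : R^o).
Proof.
move=> H; elim: s => [|i s IH].
  by apply: smooth_near_ext (smooth_near_cst (1 : R^o)) => x; rewrite big_nil.
case Pi : (P i); last by apply: smooth_near_ext IH => x; rewrite big_cons Pi.
by apply: smooth_near_ext (smooth_nearZ (H i Pi) IH) => x; rewrite big_cons Pi.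
Qed.

Lemma smooth_near_diff (W : normedModType R) (f : U -> W) v :
  smooth_near a f -> smooth_near a (fun x => 'd f x v).
Proof.
by move=> [A [Aa Cf]]; exists A; split=> // n; have [_ C] := Cf n.+1; exact: C.
Qed.

Lemma smooth_near_differentiable (W : normedModType R) (f : U -> W) :
  smooth_near a f -> \forall x \near a, differentiable f x.
Proof.
move=> [A [Aa Cf]]; have [df _] := Cf 1.
by apply: filterS (open_nbhs_nbhs Aa) => x /df.
Qed.

(** The derivative of g o f in direction v is again g composed with a derivative of f, so the
    induction closes without a chain rule for general C^n maps. *)
Lemma smooth_near_comp_lin (W W' : normedModType R) (f : U -> W)
    (g : {linear W -> W'}) :
  continuous g -> smooth_near a f -> smooth_near a (fun x => g (f x)).
Proof.
move=> cg [A [[Ao Aa] Cf0]]; exists A; split=> // n.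
elim: n f {Cf0}(Cf0 n) => [|n IH] f.
  by move=> Cf x Ax; apply: (continuous_comp (Cf x Ax)); exact: cg.
move=> [df Cf]; split=> [x Ax|v].
  by apply: differentiable_comp (df x Ax) _; exact: linear_differentiable.
apply: Cn_congr (IH _ (Cf v)) => // x Ax.
have -> : (fun y => g (f y)) = g \o f by [].
have dg : differentiable g (f x) by exact: linear_differentiable.
by rewrite (diff_comp (df x Ax) dg) /= diff_lin.
Qed.

End SmoothNear.

(** * Orthonormal coordinates *)

Section Orthonormal.
Variables (R : realType) (V : normedModType R) (ip : {dot V for idfun}).
Hypothesis ip_norm : forall x : V, `|x| ^+ 2 = ip x x.

Definition orthonormal_family n (e : 'I_n -> V) :=
  forall i j, ip (e i) (e j) = (i == j)%:R.

Definition projection n (e : 'I_n -> V) (v : V) := \sum_(i < n) ip v (e i) *: e i.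

Lemma ipC x y : ip x y = ip y x.
Proof. by rewrite hermC /= expr0 mul1r. Qed.

Lemma ipZl a x y : ip (a *: x) y = a * ip x y.
Proof. by rewrite linearZl_LR. Qed.

Lemma ipBl x y z : ip (x - y) z = ip x z - ip y z.
Proof. by rewrite linearBl. Qed.

Lemma ipDl x y z : ip (x + y) z = ip x z + ip y z.
Proof. by rewrite linearDl. Qed.

Lemma ip_suml I (s : seq I) (F : I -> V) y :
  ip (\sum_(i <- s) F i) y = \sum_(i <- s) ip (F i) y.
Proof. by rewrite linear_sumlz. Qed.

Lemma ip_projection n (e : 'I_n -> V) v j :
  orthonormal_family e -> ip (projection e v) (e j) = ip v (e j).
Proof.
move=> eo; rewrite ip_suml (bigD1 j)//= ipZl eo eqxx mulr1 big1 ?addr0//.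
by move=> i ij; rewrite ipZl eo (negbTE ij) mulr0.
Qed.

(** A vector already fixed by the projection leaves the family unchanged, so dependent vectors are
    allowed; otherwise its normalised residual is added at index 0. *)
Lemma gram_schmidt (f : nat -> V) m : exists n (e : 'I_n -> V),
  orthonormal_family e /\ forall i, (i < m)%N -> projection e (f i) = f i.
Proof.
elim: m => [|m [n [e [eo ef]]]].
  by exists 0, (fun _ => 0); split=> // -[].
set y := f m - projection e (f m).
have ye j : ip y (e j) = 0 by rewrite ipBl ip_projection// subrr.
have [y0|y0] := eqVneq y 0.
  exists n, e; split=> // i; rewrite ltnS leq_eqVlt => /orP[/eqP->|/ef//].
  by apply/esym/eqP; rewrite -subr_eq0 -/y y0.
have ny : `|y| != 0 by rewrite normr_eq0.
pose w := `|y|^-1 *: y.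
have we j : ip w (e j) = 0 by rewrite ipZl ye mulr0.
pose e' (i : 'I_n.+1) := if unlift ord0 i is Some j then e j else w.
have projE v : projection e' v = ip v w *: w + projection e v.
  rewrite /projection big_ord_recl {1 2}/e' unlift_none; congr (_ + _).
  by apply: eq_bigr => i _; rewrite /e' liftK.
exists n.+1, e'; split=> [i j|i].
  rewrite /e'; case: (unliftP ord0 i) => [i' ->|->];
    case: (unliftP ord0 j) => [j' ->|->] //.
  - by rewrite /= ipC we.
  - by rewrite /= {1}/w ipZl ipC ipZl -ip_norm expr2 (mulrA _ `|y|) mulVf// mul1r mulVf.
rewrite ltnS leq_eqVlt projE => /orP[/eqP->|im].
  (* By orthogonality the new coordinate of [f m] sees only the residual [y], and [y] is [w] scaled
     by its norm. *)
  have -> : ip (f m) w = `|y|.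
    have -> : f m = y + projection e (f m) by rewrite subrK.
    rewrite ipDl /projection ip_suml big1 => [|j _].
      by rewrite addr0 ipC ipZl -ip_norm expr2 mulrA mulVf// mul1r.
    by rewrite ipZl (ipC _ w) we mulr0.
  by rewrite scalerA divff// scale1r subrK.
rewrite ef// -(ef i im) {1}/projection ip_suml big1 ?scale0r ?add0r ?ef//.
by move=> j _; rewrite ipZl (ipC _ w) we mulr0.
Qed.

Lemma orthonormal_basis : finite_dimensional V ->
  exists n (e : 'I_n -> V), orthonormal_family e /\ forall v, projection e v = v.
Proof.
move=> [m [g gspan]].
have [n [e [eo ef]]] :=
  gram_schmidt (fun i => if insub i is Some j then g j else 0) m.
exists n, e; split=> // v; have [a ->] := gspan v.
rewrite /projection; under eq_bigr do rewrite ip_suml scaler_suml.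
rewrite exchange_big /=; apply: eq_bigr => i _.
have := ef i (ltn_ord i); rewrite valK => H.
rewrite -[in RHS]H scaler_sumr; apply: eq_bigr => j _.
by rewrite ipZl scalerA.
Qed.

(** The bound by the norm is Parseval's identity with all squares but one dropped; through it
    [ip_norm] yields the continuity of linear maps. *)
Lemma coordinates_exist : finite_dimensional V ->
  exists n (e : 'I_n -> V) (c : 'I_n -> {linear V -> R^o}),
  [/\ forall i v, `|c i v| <= `|v|, forall v, v = \sum_(i < n) c i v *: e i,
      forall i j, c i (e j) = (i == j)%:R & forall i v, c i v = ip v (e i)].
Proof.
move=> /orthonormal_basis[n [e [eo ep]]].
have lin i : linear (fun v => ip v (e i) : R^o).
  by move=> a u v; rewrite ipDl ipZl.
pose c i : {linear V -> R^o} :=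
  HB.pack (fun v => ip v (e i) : R^o) (GRing.isLinear.Build R V R^o _ _ (lin i)).
have cE i v : c i v = ip v (e i) by [].
have cle i v : `|c i v| <= `|v|.
  rewrite -(@ler_pXn2r _ 2)// ?nnegrE// ip_norm -{2}(ep v) cE.
  rewrite real_normK ?num_real// ipC ip_suml (bigD1 i)//= ipZl ipC -expr2.
  rewrite lerDl sumr_ge0// => j _; rewrite ipZl ipC -expr2; exact: sqr_ge0.
exists n, e, c; split=> [i v|v|i j|i v] //.
- by rewrite -[LHS]ep.
- by rewrite cE eo eq_sym.
Qed.

End Orthonormal.

(** * Hadamard's lemma *)

Section UnitIntegral.
Variable R : realType.
Implicit Types f g : R -> R.

Definition int01 f : R := \int[lebesgue_measure]_(s in `[0, 1]) f s.

(** Two-sided continuity, also at 0 and 1: the integrands below are defined and continuous slightly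
    beyond the interval, because the ball is open. *)
Definition cont01 f := forall s : R, 0 <= s <= 1 -> {for s, continuous f}.

Lemma cont01_within f : cont01 f -> {within `[0%R, 1%R], continuous f}.
Proof.
move=> cf; apply: continuous_in_subspaceT => s.
by rewrite inE /= in_itv /= => /cf.
Qed.

Lemma cont01_integrable f : cont01 f ->
  lebesgue_measure.-integrable `[0%R, 1%R] (EFin \o f).
Proof.
move=> /cont01_within cf.
by apply: continuous_compact_integrable => //; exact: segment_compact.
Qed.

Lemma int01D f g : cont01 f -> cont01 g ->
  int01 (fun s => f s + g s) = int01 f + int01 g.
Proof. by move=> /cont01_integrable cf /cont01_integrable cg; exact: RintegralD. Qed.

Lemma int01B f g : cont01 f -> cont01 g ->
  int01 (fun s => f s - g s) = int01 f - int01 g.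
Proof. by move=> /cont01_integrable cf /cont01_integrable cg; exact: RintegralB. Qed.

Lemma int01Z (a : R) f : cont01 f -> int01 (fun s => a * f s) = a * int01 f.
Proof. by move=> /cont01_integrable cf; exact: RintegralZl. Qed.

Lemma eq_int01 f g : (forall s : R, 0 <= s <= 1 -> f s = g s) -> int01 f = int01 g.
Proof.
by move=> fg; apply: eq_Rintegral => s; rewrite inE /= in_itv /= => /fg.
Qed.

Lemma int01_cst (a : R) : int01 (fun=> a) = a.
Proof.
rewrite /int01 Rintegral_cst// [X in fine X](_ : _ = 1%E) ?mulr1//.
by rewrite [LHS]lebesgue_measure_itv /= lte01 oppr0 adde0.
Qed.

Lemma int01_bound (M : R) f : cont01 f -> (forall s : R, 0 <= s <= 1 -> `|f s| <= M) ->
  `|int01 f| <= M.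
Proof.
move=> cf fM; have cn : cont01 (fun s => `|f s|).
  by move=> s /cf cfs; apply: cvg_norm; exact: cfs.
apply: le_trans (le_normr_Rintegral _ (cont01_integrable cf)) _ => //.
rewrite -[leRHS]int01_cst; apply: le_Rintegral => //.
- exact: cont01_integrable cn.
- by apply: (@cont01_integrable (fun=> M)) => s _; exact: cvg_cst.
Qed.

Lemma int01_derive (F f : R -> R) : cont01 f ->
  (forall s : R, 0 <= s <= 1 -> is_derive s 1 F (f s)) ->
  int01 f = F 1 - F 0.
Proof.
move=> cf dF; have cF : cont01 F.
  by move=> s /dF[dFs _]; apply/differentiable_continuous/derivable1_diffP.
have itv (s : R) : s \in `]0, 1[ -> 0 <= s <= 1.
  by rewrite in_itv /= => /andP[/ltW -> /ltW ->].
rewrite /int01 /Rintegral (continuous_FTC2 (F := F)) ?ltr01//.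
- exact: cont01_within.
- split=> [s /itv/dF[]//||].
  + by apply: cvg_at_right_filter; apply: cF; rewrite lexx ler01.
  + by apply: cvg_at_left_filter; apply: cF; rewrite lexx ler01.
- by move=> s /itv/dF dFs; rewrite derive1E derive_val.
Qed.

End UnitIntegral.

Section Lines.
Variable R : realType.

Lemma is_derive_line (U W : normedModType R) (F : U -> W) (a b : U) (t : R) :
  differentiable F (a + t *: b) ->
  is_derive t (1 : R) (fun s : R => F (a + s *: b)) ('d F (a + t *: b) b).
Proof.
move=> dF.
have dl : is_diff t (fun s : R => a + s *: b) (fun s : R => s *: b).
  have -> : (fun s : R => a + s *: b) = cst a + ( *:%R ^~ b) by [].
  by apply: is_diff_eq; rewrite add0r.
have dl' : differentiable (fun s : R => a + s *: b) t by exact: ex_diff.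
have dc : differentiable (F \o (fun s : R => a + s *: b)) t.
  exact: differentiable_comp.
apply: DeriveDef; first exact/derivable1_diffP.
by rewrite deriveE// diff_comp// /= diff_val scale1r.
Qed.

Lemma mean_value_line (U : normedModType R) (F : U -> R^o) (a b : U) :
  (forall t : R, 0 <= t <= 1 -> differentiable F (a + t *: b)) ->
  exists2 t : R, 0 <= t <= 1 & F (a + b) - F a = 'd F (a + t *: b) b.
Proof.
move=> dF; have [|||t t01 E] := @MVT_segment R (fun s : R => F (a + s *: b))
    (fun s : R => 'd F (a + s *: b) b) 0 1.
- exact: ler01.
- move=> t; rewrite in_itv /= => /andP[/ltW t0 /ltW t1].
  by apply: is_derive_line; apply: dF; rewrite t0 t1.
- apply: cont01_within => s /dF /is_derive_line[dFs _].
  by apply/differentiable_continuous/derivable1_diffP.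
exists t; first by move: t01; rewrite in_itv.
by move: E; rewrite scale1r scale0r addr0 subr0 mulr1.
Qed.

End Lines.

Lemma cvg_at (T : Type) (F : set_system T) (V W : topologicalType)
    (f : T -> V) (g : V -> W) (a : V) :
  {for a, continuous g} -> f @ F --> a -> (fun t => g (f t)) @ F --> g a.
Proof. by move=> cg cf; exact: (cvg_comp _ _ cf cg). Qed.

Section Hadamard.
Variables (R : realType) (V : normedModType R) (n : nat) (e : 'I_n -> V).
Variable c : 'I_n -> {linear V -> R^o}.
Hypothesis c_le : forall i v, `|c i v| <= `|v|.
Hypothesis c_span : forall v, v = \sum_(i < n) c i v *: e i.

Lemma coordinate_continuous i : continuous (c i).
Proof.
apply: bounded_linear_continuous; exists 1; split=> // M M1.
near=> v; apply: (le_trans (c_le i v)); apply: ltW; apply: le_lt_trans M1.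
near: v; apply/nbhs_ballP; exists 1 => //= y.
by rewrite -ball_normE /= sub0r normrN => /ltW.
Unshelve. all: by end_near. Qed.

Lemma linear_coord (W : lmodType R) (f : {linear V -> W}) v :
  f v = \sum_(i < n) c i v *: f (e i).
Proof.
by rewrite {1}(c_span v) linear_sum; apply: eq_bigr => i _; rewrite linearZ.
Qed.

Lemma findim_continuous (W : normedModType R) (f : {linear V -> W}) : continuous f.
Proof.
have -> : (f : V -> W) = fun v => \sum_(i < n) c i v *: f (e i).
  by apply/funext => v; rewrite linear_coord.
apply: continuous_big => [|i _ v]; first exact: add_continuous.
by apply: cvgZr_tmp; exact: coordinate_continuous.
Qed.

Variable r : R.
Let A := ball (0 : V) r.

Lemma ball0E (x : V) : A x = (`|x| < r) :> Prop.
Proof. by rewrite /A -ball_normE /= sub0r normrN. Qed.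

Lemma ball_shrink x (s : R) : 0 <= s <= 1 -> A x -> A (s *: x).
Proof.
rewrite !ball0E => /andP[s0 s1]; apply: le_lt_trans.
by rewrite normrZ ger0_norm// ler_piMl.
Qed.

(** Joint continuity gives, around each s, a neighbourhood of (s, 0) where the estimate holds;
    compactness of the unit interval extracts one neighbourhood of u = 0 for all s. The estimate
    compares both values with G at the centre, whence the halves of [eps]. *)
Lemma uniform_on_segment (G : V -> R^o) x : Cn_on 0 A G -> A x ->
  forall eps : R, 0 < eps -> \forall u \near (0 : V), forall s : R, 0 <= s <= 1 ->
    `|G (s *: x + u) - G (s *: x)| <= eps.
Proof.
move=> cG Ax eps eps0.
have /compact_near_coveringP cov := @segment_compact R 0 1.
have := @cov V (nbhs (0 : V)) (fun u s => `|G (s *: x + u) - G (s *: x)| <= eps) _.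
move=> H; have {}H : \forall u \near (0 : V), `[0, 1]%classic `<=`
    (fun s : R => `|G (s *: x + u) - G (s *: x)| <= eps).
  apply: H => s; rewrite /= in_itv /= => s01.
  have cGs : {for s *: x, continuous G} by apply: cG; exact: ball_shrink.
  have h0 : 0 < eps / 2 by rewrite divr_gt0.
  have c1 : (fun p : R * V => G (p.1 *: x)) @
      filter_prod (nbhs s) (nbhs (0 : V)) --> G (s *: x).
    apply: (cvg_at cGs); apply: cvgZr_tmp; exact: cvg_fst.
  have c2 : (fun p : R * V => G (p.1 *: x + p.2)) @
      filter_prod (nbhs s) (nbhs (0 : V)) --> G (s *: x).
    apply: (cvg_at cGs); rewrite -[X in _ --> X]addr0.
    apply: cvgD; [apply: cvgZr_tmp; exact: cvg_fst|exact: cvg_snd].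
  near=> p.
  have -> : G (p.1 *: x + p.2) - G (p.1 *: x) =
    (G (s *: x) - G (p.1 *: x)) - (G (s *: x) - G (p.1 *: x + p.2)).
    by rewrite opprB [RHS]addrC addrA subrK.
  rewrite (splitr eps); apply: le_trans (ler_normB _ _) _; apply: lerD.
    by near: p; move/cvgrPdist_le: c1; apply.
  by near: p; move/cvgrPdist_le: c2; apply.
by apply: filterS H => u H s s01; apply: H; rewrite /= in_itv.
Unshelve. all: by end_near. Qed.

(* The weight [s ^+ m] makes this class of averages stable under
   differentiation in [x]. *)
Definition ray_mean m (F : V -> R^o) (x : V) : R^o :=
  int01 (fun s => s ^+ m * F (s *: x)).

Lemma ray_cont m F x : Cn_on 0 A F -> A x -> cont01 (fun s => s ^+ m * F (s *: x)).
Proof.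
move=> cF Ax s s01; apply: cvgM; first exact: exprn_continuous.
apply: (cvg_at (cF _ (ball_shrink s01 Ax))).
by apply: cvgZr_tmp; exact: cvg_id.
Qed.

Lemma ray_mean_linear m (I : Type) (s : seq I) (a : I -> R) (F : I -> V -> R^o) G x :
  (forall i, Cn_on 0 A (F i)) -> (forall y, G y = \sum_(i <- s) a i * F i y) ->
  A x -> ray_mean m G x = \sum_(i <- s) a i * ray_mean m (F i) x.
Proof.
move=> cF GE Ax; have -> : G = fun y => \sum_(i <- s) a i * F i y by exact/funext.
have cS : Cn_on 0 A (fun y => \sum_(i <- s) a i * F i y : R^o).
  elim: s {GE} => [|i s IH] y Ay.
    rewrite (_ : (fun _ => _) = fun=> 0 :> R^o); first exact: cvg_cst.
    by apply/funext => z; rewrite big_nil.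
  rewrite (_ : (fun _ => _) =
    (fun z => a i * F i z + \sum_(j <- s) a j * F j z : R^o)).
    by apply: cvgD (IH y Ay); apply: cvgM; [exact: cvg_cst|exact: cF].
  by apply/funext => z; rewrite big_cons.
elim: s {GE} cS => [|i s IH] cS.
  rewrite big_nil /ray_mean -[RHS](int01_cst (0 : R)).
  by apply: eq_int01 => t _; rewrite big_nil mulr0.
have ci : cont01 (fun t => a i * (t ^+ m * F i (t *: x))).
  by move=> t t01; apply: cvgM; [exact: cvg_cst|exact: (ray_cont (cF i) Ax t01)].
have cs : Cn_on 0 A (fun y => \sum_(i <- s) a i * F i y : R^o).
  have -> : (fun y => \sum_(i <- s) a i * F i y : R^o) =
    fun y => \sum_(j <- i :: s) a j * F j y - a i * F i y.
    by apply/funext => y; rewrite big_cons addrAC subrr add0r.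
  move=> y Ay; apply: cvgB; [exact: cS|].
  by apply: cvgM; [exact: cvg_cst|exact: cF].
rewrite big_cons -IH// /ray_mean -int01Z; last exact: ray_cont.
rewrite -(int01D ci (ray_cont cs Ax)).
by apply: eq_int01 => t _; rewrite big_cons mulrDr mulrCA.
Qed.

(** Differentiation under the integral. The error of the proposed differential is one integral,
    whose integrand is bounded by [eps] times the norm of u, uniformly in s. *)
Lemma ray_mean_diff m F x : Cn_on 1 A F -> A x ->
  differentiable (ray_mean m F) x /\
  'd (ray_mean m F) x = (fun v => ray_mean m.+1 (fun y => 'd F y v) x)
    :> (V -> R^o).
Proof.
move=> [dF CF] Ax; have cF : Cn_on 0 A F.
  by move=> y /dF/differentiable_continuous.
have dlin : linear (fun v => ray_mean m.+1 (fun y => 'd F y v) x : R^o).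
  (* The combination a u + v is presented as a sum over two booleans, so that [ray_mean_linear]
     applies. *)
  move=> a u v; pose w (b : bool) := if b then u else v.
  rewrite (@ray_mean_linear m.+1 bool [:: true; false]
    (fun b => if b then a else 1) (fun b y => 'd F y (w b))) => [||y|//].
  - by rewrite !big_cons big_nil addr0 mul1r.
  - by move=> b; exact: CF.
  - by rewrite !big_cons big_nil addr0 mul1r linearP.
pose D : {linear V -> R^o} := HB.pack
  (fun v => ray_mean m.+1 (fun y => 'd F y v) x : R^o)
  (GRing.isLinear.Build R V R^o _ _ dlin).
apply: (@diff_eps _ _ _ _ D); first exact: findim_continuous.
(* Each of the n coordinates of the increment contributes one such error; n.+1 keeps the divisor
   nonzero for n = 0. *)
move=> eps eps0; have eps1 : 0 < eps / n.+1%:R by rewrite divr_gt0// ltr0n.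
have : \forall u \near (0 : V), forall (i : 'I_n) (s : R), 0 <= s <= 1 ->
    `|'d F (s *: x + u) (e i) - 'd F (s *: x) (e i)| <= eps / n.+1%:R.
  apply: filter_forall => i.
  exact: (uniform_on_segment (G := fun y => 'd F y (e i)) (CF (e i)) Ax eps1).
move=> /nbhs_ballP[d /= d0 Hd].
near=> u.
have ud : `|u| < d.
  by near: u; apply/nbhs_ballP; exists d => //= y; rewrite -ball_normE /= sub0r normrN.
have ur : `|x| + `|u| < r.
  rewrite -ltrBrDl; near: u; apply/nbhs_ballP; exists (r - `|x|) => /=.
    by rewrite subr_gt0 -ball0E.
  by move=> y; rewrite -ball_normE /= sub0r normrN.
have Axu : A (x + u) by rewrite ball0E; apply: le_lt_trans ur; exact: ler_normD.
have small (s : R) : 0 <= s <= 1 -> `|s *: u| <= `|u|.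
  by move=> /andP[s0 s1]; rewrite normrZ ger0_norm// ler_piMl.
rewrite /= /ray_mean -int01B; [|exact: ray_cont|exact: ray_cont].
rewrite -int01B; last 2 first.
- by move=> s s01; apply: cvgB; exact: ray_cont.
- exact: (@ray_cont m.+1 (fun y => 'd F y u) x (CF u) Ax).
apply: int01_bound.
  move=> s s01; apply: cvgB; last first.
    exact: (@ray_cont m.+1 (fun y => 'd F y u) x (CF u) Ax s s01).
  by apply: cvgB; exact: ray_cont.
move=> s s01; have sm : `|s ^+ m| <= 1.
  by case/andP: s01 => s0 s1; rewrite ger0_norm ?exprn_ge0// exprn_ile1.
(* The extra factor s in the weight [m.+1] is absorbed into the increment s u, which leaves the
   error of linear approximation of F at s x. *)
have -> : s ^+ m * F (s *: (x + u)) - s ^+ m * F (s *: x) -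
    s ^+ m.+1 * 'd F (s *: x) u =
    s ^+ m * (F (s *: x + s *: u) - F (s *: x) - 'd F (s *: x) (s *: u)).
  have dZ : 'd F (s *: x) (s *: u) = s * 'd F (s *: x) u by rewrite [LHS]linearZ.
  by rewrite (scalerDr s x u) dZ !mulrBr exprSr -mulrA.
rewrite normrM -[leRHS]mul1r ler_pM//.
have segm (t : R) : 0 <= t <= 1 -> A (s *: x + t *: (s *: u)).
  move=> t01; rewrite scalerA mulrC -scalerA -scalerDr; apply: ball_shrink => //.
  rewrite ball0E; apply: le_lt_trans ur; apply: le_trans (ler_normD _ _) _.
  by rewrite lerD2l; move: t01 => /andP[t0 t1]; rewrite normrZ ger0_norm// ler_piMl.
(* The mean value theorem turns this error into a difference of differentials at two points at
   distance at most the norm of u, where the uniform estimate applies coordinatewise. *)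
have [t t01 ->] :=
  @mean_value_line R V F (s *: x) (s *: u) (fun t t01 => dF _ (segm t t01)).
rewrite (linear_coord _ (s *: u)) [X in _ - X]linear_coord -sumrB.
apply: le_trans (ler_norm_sum _ _ _) _.
apply: (@le_trans _ _ (\sum_(i < n) (`|u| * (eps / n.+1%:R)))).
  apply: ler_sum => i _; rewrite -scalerBr normrM; apply: ler_pM => //.
    by apply: le_trans (c_le _ _) _; exact: small.
  apply: Hd => //; rewrite -ball_normE /= sub0r normrN; apply: le_lt_trans ud.
  apply: le_trans (small s s01); rewrite [leLHS]normrZ.
  by case/andP: t01 => t0 t1; rewrite ger0_norm// ler_piMl.
rewrite sumr_const card_ord -[leLHS]mulr_natr -(mulrA `|u|) mulrC ler_wpM2r//.
by rewrite mulrAC ler_pdivrMr ?ltr0n// ler_pM2l// ler_nat.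
Unshelve. all: by end_near. Qed.

(** The weight grows with each differentiation, so the induction on [N] is for all [m]; the base
    case is uniform continuity along the segment. *)
Lemma ray_mean_Cn m N F : Cn_on N A F -> Cn_on N A (ray_mean m F).
Proof.
have Ao : open A by exact: ball_open.
elim: N m F => [|N IH] m F; last first.
  move=> CF; have CF1 : Cn_on 1 A F.
    by elim: N {IH} F CF => // N IH F /Cn_onS; exact: IH.
  split=> [x Ax|v]; first by have [] := ray_mean_diff m CF1 Ax.
  have [_ CFv] := CF.
  apply: Cn_congr (IH m.+1 _ (CFv v)) => // x Ax.
  by have [_ ->] := ray_mean_diff m CF1 Ax.
move=> cF x Ax; apply/cvgrPdist_le => eps eps0.
have /nbhs_ballP[d /= d0 Hd] := uniform_on_segment cF Ax eps0.
near=> y.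
have ud : `|y - x| < d.
  by near: y; apply/nbhs_ballP; exists d => //= y; rewrite -ball_normE /= distrC.
have Ay : A y by near: y; apply: open_nbhs_nbhs.
rewrite /ray_mean -int01B; [|exact: ray_cont|exact: ray_cont].
apply: int01_bound.
  by move=> s s01; apply: cvgB; exact: ray_cont.
move=> s s01; have /andP[s0 s1] := s01; rewrite -mulrBr normrM -[leRHS]mul1r.
rewrite ler_pM//; first by rewrite ger0_norm ?exprn_ge0// exprn_ile1.
have -> : s *: y = s *: x + s *: (y - x) by rewrite -scalerDr addrC subrK.
rewrite distrC; apply: Hd => //; rewrite -ball_normE /= sub0r normrN.
by apply: le_lt_trans ud; rewrite normrZ ger0_norm// ler_piMl.
Unshelve. all: by end_near. Qed.

End Hadamard.

(** * Powers of the maximal ideal *)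

Section MpowTheory.
Variables (R : realType) (V : normedModType R).

Lemma Mpow_near j (f g : V -> V) :
  (\forall x \near (0 : V), f x = g x) -> Mpow V j f -> Mpow V j g.
Proof.
move=> fg [m [a [u [ha hu E]]]]; exists m, a, u; split=> //.
by near=> x; rewrite -(near fg x)//; near: x.
Unshelve. all: by end_near. Qed.

Lemma Mpow_ext j (f g : V -> V) : f =1 g -> Mpow V j f -> Mpow V j g.
Proof. by move=> fg; apply: Mpow_near; exact: nearW. Qed.

Lemma MpowD j (f g : V -> V) :
  Mpow V j f -> Mpow V j g -> Mpow V j (fun x => f x + g x).
Proof.
move=> [m1 [a1 [u1 [ha1 hu1 E1]]]] [m2 [a2 [u2 [ha2 hu2 E2]]]].
exists (m1 + m2)%N,
  (fun i : 'I_(m1 + m2) =>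
     match fintype.split i with inl k => a1 k | inr k => a2 k end),
  (fun i : 'I_(m1 + m2) =>
     match fintype.split i with inl k => u1 k | inr k => u2 k end); split.
- by move=> i l; case: (fintype.split i).
- by move=> i; case: (fintype.split i).
near=> x; rewrite big_split_ord /= (near E1 x)// (near E2 x)//.
by congr (_ + _); apply: eq_bigr => i _;
  [rewrite (unsplitK (inl i : 'I_m1 + 'I_m2))|
   rewrite (unsplitK (inr i : 'I_m1 + 'I_m2))].
Unshelve. all: by end_near. Qed.

Lemma Mpow0 j : Mpow V j (fun=> 0).
Proof.
exists 0, (fun _ _ _ => 0), (fun _ _ => 0); split => [[]//|[]//|].
by apply: nearW => x; rewrite big_ord0.
Qed.

Lemma Mpow_sum j (I : Type) (s : seq I) (P : pred I) (f : I -> V -> V) :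
  (forall i, P i -> Mpow V j (f i)) ->
  Mpow V j (fun x => \sum_(i <- s | P i) f i x).
Proof.
move=> H; elim: s => [|i s IH].
  by apply: Mpow_ext (Mpow0 j) => x; rewrite big_nil.
case Pi : (P i); last by apply: Mpow_ext IH => x; rewrite big_cons Pi.
by apply: Mpow_ext (MpowD (H i Pi) IH) => x; rewrite big_cons Pi.
Qed.

Lemma smooth_Mpow0 (g : V -> V) : smooth_near 0 g -> Mpow V 0 g.
Proof.
move=> sg; exists 1, (fun _ _ _ => 0), (fun _ => g); split => // [? []//|].
by apply: nearW => x; rewrite big_ord1 big_ord0 scale1r.
Qed.

Lemma Mpow_smoothZ j (b : V -> R^o) (f : V -> V) :
  smooth_near 0 b -> Mpow V j f -> Mpow V j (fun x => (b x : R) *: f x).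
Proof.
move=> sb [m [a [u [ha hu E]]]]; exists m, a, (fun i x => b x *: u i x).
split=> // [i|]; first exact: (smooth_nearZ sb (hu i)).
near=> x; rewrite (near E x)// scaler_sumr; apply: eq_bigr => i _.
by rewrite !scalerA mulrC.
Unshelve. all: by end_near. Qed.

Lemma Mpow_idealZ j (b : V -> R^o) (f : V -> V) :
  max_ideal b -> Mpow V j f -> Mpow V j.+1 (fun x => (b x : R) *: f x).
Proof.
move=> hb [m [a [u [ha hu E]]]].
exists m, (fun i (l : 'I_j.+1) => if unlift ord0 l is Some l' then a i l' else b), u.
split=> // [i l|]; first by case: (unlift ord0 l).
near=> x; rewrite (near E x)// scaler_sumr; apply: eq_bigr => i _.
rewrite big_ord_recl unlift_none scalerA; congr ((_ * _) *: _).
by apply: eq_bigr => l _; rewrite liftK.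
Unshelve. all: by end_near. Qed.

Lemma Mpow_prodZ j (I : Type) (s : seq I) (P : pred I) (a : I -> V -> R^o)
    (f : V -> V) : (forall i, P i -> max_ideal (a i)) -> Mpow V j f ->
  Mpow V (count P s + j) (fun x => (\prod_(i <- s | P i) (a i x : R)) *: f x).
Proof.
move=> H hf; elim: s => [|i s IH].
  by apply: Mpow_ext hf => x; rewrite big_nil scale1r.
rewrite /=; case Pi : (P i); last by apply: Mpow_ext IH => x; rewrite big_cons Pi.
by apply: Mpow_ext (Mpow_idealZ (H i Pi) IH) => x; rewrite big_cons Pi scalerA.
Qed.

Variables (n : nat) (e : 'I_n -> V) (c : 'I_n -> {linear V -> R^o}).
Hypothesis c_le : forall i v, `|c i v| <= `|v|.
Hypothesis c_span : forall v, v = \sum_(i < n) c i v *: e i.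

Let c_cont i : continuous (c i) := @coordinate_continuous R V n c c_le i.

Lemma linear_max_ideal (a : {linear V -> R^o}) : max_ideal a.
Proof.
split; last exact: linear0.
by apply: smooth_near_lin; exact: (@findim_continuous R V n e c c_le c_span).
Qed.

Lemma vanishing_Mpow1 (g : V -> V) : smooth_near 0 g -> g 0 = 0 -> Mpow V 1 g.
Proof.
move=> sg g0; apply: (@Mpow_ext _ (fun x => \sum_(i < n) c i (g x) *: e i)).
  by move=> x; rewrite -c_span.
apply: Mpow_sum => i _; apply: (@Mpow_idealZ _ (fun x => c i (g x))).
  by split; [apply: smooth_near_comp_lin|rewrite g0 linear0].
by apply: smooth_Mpow0; exact: smooth_near_cst.
Qed.

Lemma hadamard (a : V -> R^o) : smooth_near 0 a ->
  exists b : 'I_n -> V -> R^o,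
  [/\ forall i, smooth_near 0 (b i), forall i, b i 0 = 'd a 0 (e i) &
    \forall x \near (0 : V), a x - a 0 = \sum_(i < n) c i x * b i x].
Proof.
move=> [A [[Ao A0] Ca]].
have /nbhs_ballP[r /= r0 rA] : nbhs (0 : V) A by exact: open_nbhs_nbhs.
have Cb N : Cn_on N (ball (0 : V) r) a by exact: Cn_subset (Ca N).
have [dF _] := Cb 1.
have Cd N i : Cn_on N (ball (0 : V) r) (fun y => 'd a y (e i)).
  by have [_] := Cb N.+1; exact.
exists (fun i => ray_mean 0 (fun y => 'd a y (e i))); split.
- move=> i; exists (ball 0 r); split; first by split; [exact: ball_open|exact: ballxx].
  by move=> N; exact: (ray_mean_Cn c_le c_span).
- move=> i; rewrite -[RHS](int01_cst ('d a 0 (e i) : R)); apply: eq_int01 => s _.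
  by rewrite expr0 mul1r scaler0.
near=> x; have Ax : ball (0 : V) r x by near: x; apply/nbhs_ballP; exists r.
(* With the direction x frozen, the sum over i is the mean of y |-> 'd a y x along the ray, and at y
   = s x this integrand is the derivative of a(s x) in s. *)
rewrite -(@ray_mean_linear _ _ r 0 _ _ (fun i => c i x)
  (fun i y => 'd a y (e i)) (fun y => 'd a y x))//.
- have cx : cont01 (fun s => 'd a (s *: x) x).
    move=> s s01; apply: (cvg_at (g := fun y => 'd a y x)).
      by apply: (Cb 1).2; exact: ball_shrink.
    by apply: cvgZr_tmp; exact: cvg_id.
  have dx (s : R) : 0 <= s <= 1 ->
      is_derive s 1 (fun s => a (0 + s *: x)) ('d a (s *: x) x).
    move=> s01; rewrite -[X in 'd a X](add0r (s *: x)); apply: is_derive_line.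
    by rewrite add0r; apply: dF; exact: ball_shrink.
  have := int01_derive cx dx; rewrite scale1r scale0r add0r addr0 => <-.
  by apply: eq_int01 => s _; rewrite expr0 mul1r.
- by move=> y; rewrite (linear_coord c_span ('d a y) x).
Unshelve. all: by end_near. Qed.

(** Subtracting the linear part replaces [b i] by [b i - b i 0] in Hadamard's formula, so every term
    is a product of two elements of the ideal. *)
Lemma Mpow_order2Z j (a : V -> R^o) (f : V -> V) : max_ideal a -> Mpow V j f ->
  Mpow V j.+2 (fun x => (a x - 'd a 0 x : R) *: f x).
Proof.
move=> [sa a0] hf; have [b [sb b0 E]] := hadamard sa.
apply: (@Mpow_near _ (fun x => \sum_(i < n) c i x *: ((b i x - b i 0) *: f x))).
  near=> x; have -> : a x = \sum_(i < n) c i x * b i x.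
    by rewrite -(near E x)// a0 subr0.
  rewrite (linear_coord c_span ('d a 0) x) -sumrB scaler_suml; apply: eq_bigr => i _.
  by rewrite scalerA b0 mulrBr.
apply: Mpow_sum => i _; apply: Mpow_idealZ; first exact: linear_max_ideal.
apply: (@Mpow_idealZ _ (fun x => b i x - b i 0)) => //; split; last exact: subrr.
by apply: (@smooth_nearD _ _ _ _ _ (fun=> - b i 0)) => //; exact: smooth_near_cst.
Unshelve. all: by end_near. Qed.

(** Telescoping: with a' the linear part of a and B the product of the remaining linear parts, a A g
    - a' B g(0) = a (A g - B g(0)) + (a - a') B g(0). The first term gains an order from a, the
    second gains two from a - a'. *)
Lemma Mpow_leading_monomial (I : Type) (s : seq I) (a : I -> V -> R^o) (g : V -> V) :
  (forall i, max_ideal (a i)) -> smooth_near 0 g ->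
  Mpow V (size s).+1 (fun x => (\prod_(i <- s) (a i x : R)) *: g x -
                              (\prod_(i <- s) ('d (a i) 0 x : R)) *: g 0).
Proof.
move=> ha sg; elim: s => [|i s IH].
  apply: (@Mpow_ext _ (fun x => g x - g 0)).
    by move=> x; rewrite !big_nil !scale1r.
  apply: vanishing_Mpow1; last exact: subrr.
  by apply: (@smooth_nearD _ _ _ _ _ (fun=> - g 0)) => //; exact: smooth_near_cst.
pose q x := (\prod_(k <- s) ('d (a k) 0 x : R)) *: g 0.
have hq : Mpow V (size s) q.
  rewrite -(count_predT s) -(addn0 (count _ _)); apply: Mpow_prodZ.
    by move=> k _; exact: linear_max_ideal.
  by apply: smooth_Mpow0; exact: smooth_near_cst.
apply: Mpow_ext (MpowD (Mpow_idealZ (ha i) IH) (Mpow_order2Z (ha i) hq)) => x.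
rewrite /= !big_cons /q scalerBr scalerBl !scalerA addrA subrK.
by [].
Qed.

Lemma Mpow_leading_term j (f : V -> V) : Mpow V j f ->
  exists2 p, homog j p & Mpow V j.+1 (fun x => f x - p x).
Proof.
move=> [m [a [g [ha hg E]]]].
exists (fun x => \sum_(i < m) (\prod_(l < j) 'd (a i l) 0 x) *: g i 0).
  by exists m, (fun i l => 'd (a i l) 0), (fun i => g i 0).
apply: (@Mpow_near _ (fun x => \sum_(i < m) ((\prod_(l < j) (a i l x : R)) *: g i x -
                              (\prod_(l < j) ('d (a i l) 0 x : R)) *: g i 0))).
  by near=> x; rewrite (near E x)// sumrB.
apply: Mpow_sum => i _.
have := @Mpow_leading_monomial _ (index_enum 'I_j) (a i) (g i) (ha i) (hg i).
by rewrite /index_enum; case: index_enum_key; rewrite /= -enumT size_enum_ord.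
Unshelve. all: by end_near. Qed.

End MpowTheory.

(** * The splitting of homogeneous maps *)

Section OrthogonalSplitting.
Variables (F : realFieldType).

Lemma mulmx_tr_eq0 n (u : 'rV[F]_n) : u *m u^T = 0 -> u = 0.
Proof.
move=> /matrixP/(_ 0 0); rewrite !mxE => /eqP.
rewrite psumr_eq0 => [/allP H|i _]; last by rewrite mxE -expr2 sqr_ge0.
apply/rowP => i; have := H i (mem_index_enum _).
by rewrite !mxE /= -expr2 sqrf_eq0 => /eqP.
Qed.

(** If u = D M and u M^T = 0, then u u^T = 0 and u = 0. The row space of M thus misses the kernel of
    M^T, so M M^T has the rank of M, and its row space fills that of M^T. *)
Lemma tr_sub_mulmx_tr n (M : 'M[F]_n) : (M^T <= M *m M^T)%MS.
Proof.
have cap0 : (M :&: kermx M^T)%MS = 0.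
  apply/eqP; rewrite -submx0; apply/row_subP => i.
  set u := row i _.
  have uM : (u <= M)%MS by apply: submx_trans (row_sub _ _) (capmxSl _ _).
  have uK : (u <= kermx M^T)%MS by apply: submx_trans (row_sub _ _) (capmxSr _ _).
  have /submxP[D uD] := uM; rewrite submx0; apply/eqP/mulmx_tr_eq0.
  by rewrite [in X in _ *m X]uD trmx_mul mulmxA (sub_kermxP uK) mul0mx.
have := mxrank_mul_ker M M^T; rewrite cap0 mxrank0 addn0 => rk.
by rewrite -(mxrank_leqif_sup (submxMl M M^T)).2 rk mxrank_tr.
Qed.

(** These are the normal equations: d M is the orthogonal projection of w to the row space of M, and
    the residual is killed by M^T. *)
Lemma fin_orthogonal_splitting (K : finType) (m : K -> K -> F) (w : K -> F) :
  exists d w' : K -> F, (forall k, w k = \sum_i d i * m i k + w' k) /\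
    (forall i, \sum_k m i k * w' k = 0).
Proof.
pose M : 'M[F]_#|K| := \matrix_(i, j) m (enum_val i) (enum_val j).
pose W : 'rV[F]_#|K| := \row_j w (enum_val j).
have /submxP[D WD] : (W *m M^T <= M *m M^T)%MS.
  exact: submx_trans (submxMl _ _) (tr_sub_mulmx_tr M).
pose W' := W - D *m M.
exists (fun i => D 0 (enum_rank i)), (fun i => W' 0 (enum_rank i)); split.
  move=> k; have -> : \sum_i D 0 (enum_rank i) * m i k = (D *m M) 0 (enum_rank k).
    rewrite mxE (reindex_onto (@enum_val K predT) enum_rank) /=; last first.
      by move=> i _; exact: enum_rankK.
    apply: eq_big => [i|i _]; first by rewrite enum_valK eqxx.
    by rewrite enum_valK mxE enum_rankK.
  have /matrixP/(_ 0 (enum_rank k)) : W = D *m M + W' by rewrite addrC subrK.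
  by rewrite mxE enum_rankK => ->; rewrite mxE.
move=> i; have : (W' *m M^T) 0 (enum_rank i) = 0.
  by rewrite mulmxBl -mulmxA -WD subrr mxE.
rewrite mxE => E; rewrite -[RHS]E.
rewrite (reindex_onto (@enum_val K predT) enum_rank) /=; last first.
  by move=> k _; exact: enum_rankK.
apply: eq_big => [k|k _]; first by rewrite enum_valK eqxx.
by rewrite enum_valK mulrC [M^T _ _]mxE [M _ _]mxE enum_rankK.
Qed.

End OrthogonalSplitting.

(** * Differentials of sums and of products of linear forms *)

Section DiffSums.
Variables (R : realType) (V : normedModType R).

Lemma diff_sumE (W : normedModType R) (I : Type) (s : seq I) (f : I -> V -> W) x :
  (forall i, differentiable (f i) x) ->
  differentiable (fun y => \sum_(i <- s) f i y) x /\
  'd (fun y => \sum_(i <- s) f i y) x = (fun v => \sum_(i <- s) 'd (f i) x v) :> (V -> W).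
Proof.
move=> df; elim: s => [|i s [IHd IHv]].
  rewrite (_ : (fun y => _) = cst 0); last by apply/funext => y; rewrite big_nil.
  split; first exact: differentiable_cst.
  by rewrite diff_cst; apply/funext => v; rewrite big_nil.
rewrite (_ : (fun y => _) = f i + (fun y => \sum_(i <- s) f i y)); last first.
  by apply/funext => y; rewrite big_cons.
split; first exact: differentiableD.
rewrite (diffD (df i) IHd).
apply/funext => v.
rewrite big_cons.
change ('d (f i) x v + 'd (fun y : V => \sum_(i <- s) f i y) x v =
  'd (f i) x v + \sum_(j <- s) 'd (f j) x v).
by rewrite IHv.
Qed.

Lemma diff_scaleC (W : normedModType R) (a : R) (f : V -> W) x :
  differentiable f x -> differentiable (fun y => a *: f y) x /\
  'd (fun y => a *: f y) x = (fun v => a *: 'd f x v) :> (V -> W).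
Proof.
by move=> df; have -> : (fun y => a *: f y) = a *: f by []; split;
  [exact: differentiableZ|rewrite diffZ].
Qed.

Lemma diff_prod_linear l (a : 'I_l -> {linear V -> R^o}) x :
  (forall i, continuous (a i)) ->
  differentiable (fun y => \prod_(i < l) (a i y : R) : R^o) x /\
  'd (fun y => \prod_(i < l) (a i y : R) : R^o) x =
    (fun v => \sum_(m < l) (a m v : R) * \prod_(i < l | i != m) (a i x : R))
    :> (V -> R^o).
Proof.
elim: l a => [|l IH] a ca.
  rewrite (_ : (fun y => _) = cst (1 : R^o)); last by apply/funext => y; rewrite big_ord0.
  split; first exact: differentiable_cst.
  by rewrite diff_cst; apply/funext => v; rewrite big_ord0.
have [dP vP] := IH (fun i => a (lift ord0 i)) (fun i => ca _).
have da : differentiable (a ord0) x by exact: linear_differentiable.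
rewrite (_ : (fun y => _) = fun y =>
  (a ord0 y) *: (\prod_(i < l) (a (lift ord0 i) y : R) : R^o)); last first.
  by apply/funext => y; rewrite big_ord_recl.
have [dS vS] := diff_scale da dP.
split; first exact: dS.
rewrite vS; apply/funext => v; rewrite vP diff_lin//.
rewrite big_ord_recl; congr (_ * _ + _).
  by rewrite [RHS]big_mkcond big_ord_recl /= mul1r; apply: eq_bigr => i _.
rewrite [LHS]mulr_sumr; apply: eq_bigr => m _; rewrite mulrCA; congr (_ * _).
rewrite [RHS]big_mkcond big_ord_recl /= [in LHS]big_mkcond; congr (_ * _).
Qed.

End DiffSums.

(** * The bracket as a matrix on tensors of coefficients *)

Section TensorMonomials.
Variables (R : realType) (V : normedModType R).
Variables (n : nat) (e : 'I_n -> V) (c : 'I_n -> {linear V -> R^o}).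
Hypothesis c_le : forall i v, `|c i v| <= `|v|.
Hypothesis c_span : forall v, v = \sum_(i < n) c i v *: e i.

Let c_cont i : continuous (c i) := @coordinate_continuous R V n c c_le i.

Variable l : nat.

(* The map from tensors to polynomials is not injective: no symmetry of the
   coefficients is imposed, the splitting being done on tensors. *)
Definition tensor_index := ({ffun 'I_l -> 'I_n} * 'I_n)%type.

Definition monomial (k : tensor_index) (x : V) : V :=
  (\prod_(j < l) (c (k.1 j) x : R)) *: e k.2.

Definition tensor_poly (w : tensor_index -> R) (x : V) : V :=
  \sum_k w k *: monomial k x.

(** Every form and every vector is expanded in coordinates; a product of l sums over n indices
    becomes a sum over all functions from positions to indices. *)
Lemma homog_tensor (p : V -> V) : homog l p -> exists w, p = tensor_poly w.
Proof.
move=> [m [a [v ->]]].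
exists (fun k : tensor_index =>
  \sum_(i < m) (\prod_(j < l) a i j (e (k.1 j))) * c k.2 (v i)).
apply/funext => x; rewrite /tensor_poly.
under [RHS]eq_bigr do rewrite scaler_suml.
rewrite exchange_big /=; apply: eq_bigr => i _.
rewrite {1}(c_span (v i)) scaler_sumr.
rewrite -(pair_bigA _ (fun (I : {ffun 'I_l -> 'I_n}) j =>
  ((\prod_(j0 < l) a i j0 (e (I j0))) * c j (v i)) *: monomial (I, j) x)) /=.
rewrite exchange_big /=; apply: eq_bigr => r _.
have -> : \prod_(j < l) a i j x = \prod_(j < l) \sum_(s < n) (c s x * a i j (e s)).
  apply: eq_bigr => j _; rewrite {1}(c_span x) linear_sum.
  by apply: eq_bigr => s _; rewrite linearZ.
rewrite bigA_distr_bigA /= scaler_suml; apply: eq_bigr => I _.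
rewrite /monomial !scalerA big_split /=; congr (_ *: _).
by rewrite [RHS]mulrC [RHS]mulrA.
Qed.

Lemma tensor_homog w : homog l (tensor_poly w).
Proof.
pose k (i : 'I_#|{: tensor_index}|) : tensor_index := enum_val i.
exists #|{: tensor_index}|, (fun i j => c ((k i).1 j)),
  (fun i => w (k i) *: e (k i).2).
apply/funext => x; rewrite /tensor_poly.
rewrite (reindex_onto (@enum_val tensor_index predT) enum_rank) /=; last first.
  by move=> i _; exact: enum_rankK.
apply: eq_big => [i|i _]; first by rewrite enum_valK eqxx.
by rewrite /monomial scalerA mulrC -scalerA.
Qed.

Lemma diff_monomial k x : differentiable (monomial k) x /\
  'd (monomial k) x = (fun v => (\sum_(m < l) (c (k.1 m) v : R) *
      \prod_(j < l | j != m) (c (k.1 j) x : R)) *: e k.2) :> (V -> V).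
Proof.
have [dP vP] := diff_prod_linear x (fun j => @c_cont (k.1 j)).
split; first exact: (@differentiableZl _ _ _ (fun y => \prod_(j < l) (c (k.1 j) y : R))).
rewrite (@diffZl _ _ _ (fun y => \prod_(j < l) (c (k.1 j) y : R)) (e k.2))//.
by apply/funext => v; rewrite vP.
Qed.

Lemma diff_tensor_poly w x : differentiable (tensor_poly w) x /\
  'd (tensor_poly w) x = (fun v => \sum_k w k *: 'd (monomial k) x v) :> (V -> V).
Proof.
have H k := diff_scaleC (w k) (diff_monomial k x).1.
have [dS vS] := diff_sumE (index_enum tensor_index) (fun k => (H k).1).
split; first exact: dS.
rewrite [LHS]vS; apply/funext => v; apply: eq_bigr => k _.
by have [_ ->] := H k.
Qed.

(** The operator ad_A of the overview: the Lie bracket, up to sign, of the linear field A and the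
    field p. *)
Definition bracket (A : V -> V) (p : V -> V) (x : V) : V := 'd p x (A x) - A (p x).

Lemma bracket_tensor_poly (A : {linear V -> V}) w x :
  bracket A (tensor_poly w) x = \sum_k w k *: bracket A (monomial k) x.
Proof.
rewrite /bracket (diff_tensor_poly w x).2 /tensor_poly linear_sum -sumrB.
by apply: eq_bigr => k _; rewrite linearZ -scalerBr.
Qed.

Definition agree_off (m : 'I_l) (I J : {ffun 'I_l -> 'I_n}) :=
  [forall j, (j != m) ==> (I j == J j)].

(** ad_A is a derivation, so it changes one slot of a tensor at a time: the first term composes the
    form in slot m with A, the second applies A to the vector [e k.2]. *)
Definition bracket_mx (A : V -> V) (k k' : tensor_index) : R :=
  (k.2 == k'.2)%:R * (\sum_(m < l) (agree_off m k.1 k'.1)%:R * c (k.1 m) (A (e (k'.1 m))))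
  - (k.1 == k'.1)%:R * c k'.2 (A (e k.2)).

Lemma sum_agree_off (W : zmodType) m I (G : {ffun 'I_l -> 'I_n} -> W) :
  \sum_(J | agree_off m I J) G J =
  \sum_(r < n) G [ffun j => if j == m then r else I j].
Proof.
rewrite (reindex_onto (fun r => [ffun j => if j == m then r else I j])
  (fun J : {ffun 'I_l -> 'I_n} => J m)) /=; last first.
  move=> J /forallP IJ; apply/ffunP => j; rewrite ffunE.
  by case: eqVneq => [->//|jm]; have /implyP/(_ jm)/eqP := IJ j.
apply: eq_bigl => r; rewrite ffunE eqxx eqxx andbT.
by apply/forallP => j; rewrite ffunE; apply/implyP => /negbTE ->.
Qed.

Lemma bracket_monomial (A : {linear V -> V}) k x :
  bracket A (monomial k) x = \sum_k' bracket_mx A k k' *: monomial k' x.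
Proof.
have cA i y : c i (A y) = \sum_(r < n) c r y * c i (A (e r)).
  rewrite {1}(c_span y) !linear_sum; apply: eq_bigr => r _.
  by rewrite linearZ /= linearZ.
case: k => I i; rewrite /bracket (diff_monomial (I, i) x).2 /=.
under [RHS]eq_bigr do rewrite /bracket_mx scalerBl.
rewrite sumrB; congr (_ - _).
  rewrite -(pair_bigA _ (fun (J : {ffun 'I_l -> 'I_n}) j =>
    ((i == j)%:R * \sum_(m < l) (agree_off m I J)%:R * c (I m) (A (e (J m)))) *:
      monomial (J, j) x)) /=.
  have sJ (J : {ffun 'I_l -> 'I_n}) : \sum_(j < n) ((i == j)%:R *
      \sum_(m < l) (agree_off m I J)%:R * c (I m) (A (e (J m)))) *:
        monomial (J, j) x =
      (\sum_(m < l) (agree_off m I J)%:R * c (I m) (A (e (J m))) *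
        \prod_(j < l) (c (J j) x : R)) *: e i.
    rewrite (bigD1 i)//= eqxx mul1r [X in _ + X = _]big1 ?addr0 => [|j]; last first.
      by rewrite eq_sym => /negbTE ->; rewrite mul0r scale0r.
    by rewrite /monomial /= scalerA mulr_suml.
  under [RHS]eq_bigr do rewrite sJ.
  rewrite -scaler_suml exchange_big /=; congr (_ *: _); apply: eq_bigr => m _.
  under [RHS]eq_bigr do rewrite -mulrA mulr_natl mulrb.
  (* Multi-indices that agree with I off m are parametrised by their value r at m, which matches the
     expansion of c (I m) (A x). *)
  rewrite -[RHS]big_mkcond [RHS]sum_agree_off cA mulr_suml; apply: eq_bigr => r _.
  rewrite ffunE eqxx [in RHS](bigD1 m)//= ffunE eqxx mulrA (mulrC (c r x)) -!mulrA.
  congr (_ * (_ * _)); apply: eq_bigr => j jm.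
  by rewrite ffunE (negbTE jm).
rewrite -(pair_bigA _ (fun (J : {ffun 'I_l -> 'I_n}) j =>
    ((I == J)%:R * c j (A (e i))) *: monomial (J, j) x)) /=.
rewrite (bigD1 I)//= [X in _ = _ + X]big1 ?addr0; last first.
  by move=> J IJ; rewrite big1// => j _; rewrite eq_sym (negbTE IJ) mul0r scale0r.
rewrite /monomial linearZ /= {1}(c_span (A (e i))) scaler_sumr.
by apply: eq_bigr => j _; rewrite eqxx mul1r /= !scalerA mulrC.
Qed.

(** Every entry is built from symmetric index conditions and coefficients c i (A (e r)) joining a
    row index to a column index; exchanging rows and columns transposes these coefficients. *)
Lemma bracket_mx_adjoint (A At : V -> V) k k' :
  (forall i r, c i (A (e r)) = c r (At (e i))) ->
  bracket_mx At k k' = bracket_mx A k' k.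
Proof.
move=> adj; rewrite /bracket_mx; congr (_ * _ - _ * _).
- by rewrite eq_sym.
- apply: eq_bigr => m _; rewrite adj; congr (_%:R * _).
  by congr nat_of_bool; apply: eq_forallb => j; rewrite (eq_sym (k.1 j)).
- by rewrite eq_sym.
- by rewrite adj.
Qed.

Lemma homog_splitting (A At : {linear V -> V}) (p : V -> V) :
  (forall i r, c i (A (e r)) = c r (At (e i))) -> homog l p ->
  exists q s : V -> V, [/\ homog l q, homog l s,
    forall x, p x = bracket A q x + s x & forall x, bracket At s x = 0].
Proof.
move=> adj /homog_tensor[w ->].
have [d [w' [wE w'0]]] := fin_orthogonal_splitting (bracket_mx A) w.
exists (tensor_poly d), (tensor_poly w'); split; try exact: tensor_homog.
  move=> x; rewrite bracket_tensor_poly {1}/tensor_poly.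
  under eq_bigr do rewrite wE scalerDl scaler_suml.
  rewrite big_split /=; congr (_ + _); rewrite exchange_big /=.
  apply: eq_bigr => k _; rewrite bracket_monomial scaler_sumr.
  by apply: eq_bigr => k' _; rewrite scalerA.
move=> x; rewrite bracket_tensor_poly.
under eq_bigr do rewrite bracket_monomial scaler_sumr.
rewrite exchange_big /= big1// => k' _.
(* The coefficient of [monomial k'] is now the k'-th orthogonality relation for w'. *)
under eq_bigr => k _ do rewrite scalerA (bracket_mx_adjoint _ _ adj) mulrC.
by rewrite -scaler_suml w'0 scale0r.
Qed.

Lemma homog_differentiable (p : V -> V) x : homog l p -> differentiable p x.
Proof. by move=> /homog_tensor[w ->]; have [] := diff_tensor_poly w x. Qed.

End TensorMonomials.

(** * Equivariance *)

Section LinearFlow.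
Variables (R : realType) (V : normedModType R).
Variables (n : nat) (e : 'I_n -> V) (c : 'I_n -> {linear V -> R^o}).
Hypothesis c_le : forall i v, `|c i v| <= `|v|.
Hypothesis c_span : forall v, v = \sum_(i < n) c i v *: e i.
Variable N : {linear V -> V}.

Let c_cont i : continuous (c i) := @coordinate_continuous R V n c c_le i.
Let N_cont : continuous N := @findim_continuous R V n e c c_le c_span V N.

(** Taylor coefficients in t of the i-th coordinate of e^{tN} x: scalar power series permit termwise
    differentiation. *)
Definition flow_coef i (x : V) : R ^nat := fun k => c i (iter k N x) / k`!%:R.

Definition flow_coord i (t : R) (x : V) : R := limn (pseries (flow_coef i x) t).

Definition flow (t : R) (x : V) : V := \sum_(i < n) flow_coord i t x *: e i.

Lemma iter_linear k a u v : iter k N (a *: u + v) = a *: iter k N u + iter k N v.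
Proof. by elim: k => //= k ->; rewrite linearP. Qed.

(** With C a Lipschitz constant of N, the absolute values of the terms are dominated by those of the
    series of |x| e^{C|t|}. *)
Lemma cvg_flow_coef i x t : cvgn (pseries (flow_coef i x) t).
Proof.
have [C C0 HC] := linear_lipschitz N_cont.
have HI k : `|iter k N x| <= C ^+ k * `|x|.
  elim: k => [|k IH]; first by rewrite expr0 mul1r.
  by rewrite iterS exprS -mulrA; apply: le_trans (HC _) _; rewrite ler_pM2l.
apply: normed_cvg.
apply: (@series_le_cvg _ _ (`|x| *: exp_coeff (C * `|t|))) => [k|k|k|].
- exact: normr_ge0.
- by rewrite /= mulr_ge0// exp_coeff_ge0// mulr_ge0// ltW.
- have -> : (`|x| *: exp_coeff (C * `|t|)) k = C ^+ k * `|x| / k`!%:R * `|t| ^+ k.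
    rewrite -[LHS]/(`|x| * ((C * `|t|) ^+ k / k`!%:R)) exprMn.
    rewrite [LHS]mulrC -!mulrA; congr (_ * _).
    by rewrite [LHS]mulrC (mulrC _ `|x|) -mulrA.
  rewrite /flow_coef /= !normrM normrX normfV (ger0_norm (ler0n _ _)).
  rewrite ler_wpM2r ?exprn_ge0// ler_wpM2r ?invr_ge0//.
  exact: le_trans (c_le _ _) (HI k).
- by apply: is_cvg_seriesZ; exact: is_cvg_series_exp_coeff.
Qed.

(** The factor k+1 from differentiation cancels against (k+1)!, leaving one extra application of N:
    d/dt e^{tN} x = e^{tN} N x. *)
Lemma flow_coef_diffs i x : pseries_diffs (flow_coef i x) = flow_coef i (N x).
Proof.
apply/funext => k; rewrite /pseries_diffs /flow_coef -iterSr factS natrM invfM.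
by rewrite mulrCA (mulrA k.+1%:R) mulfV ?mul1r// pnatr_eq0.
Qed.

Lemma is_derive_flow_coord i x (t : R) :
  is_derive t 1 (fun s => flow_coord i s x) (flow_coord i t (N x)).
Proof.
rewrite /flow_coord -flow_coef_diffs.
(* Termwise differentiation at t asks for convergence at a point of larger modulus; the series
   converge everywhere. *)
apply: (@pseries_snd_diffs _ _ (`|t| + 1)); rewrite ?flow_coef_diffs;
  [exact: cvg_flow_coef..|].
by rewrite [ltRHS]ger0_norm ?addr_ge0// ltrDl.
Qed.

Lemma flow_coord0 i x : flow_coord i 0 x = c i x.
Proof.
apply/cvg_lim => //; apply: cvg_near_cst; exists 1 => // k /= k0.
rewrite /pseries /series /= -(prednK k0) big_nat_recl// big1 => [|j _].
  by rewrite expr0 mulr1 addr0 /flow_coef /= fact0 divr1.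
by rewrite expr0n mulr0.
Qed.

Lemma flow_coord_linear i t a u v :
  flow_coord i t (a *: u + v) = a * flow_coord i t u + flow_coord i t v.
Proof.
apply/cvg_lim => //.
have -> : pseries (flow_coef i (a *: u + v)) t =
  (fun k => a * pseries (flow_coef i u) t k + pseries (flow_coef i v) t k).
  apply/funext => k; rewrite /pseries /series /= mulr_sumr -big_split /=.
  apply: eq_bigr => j _; rewrite /flow_coef iter_linear linearP /=.
  by rewrite -[a *: _]/(a * _) !mulrDl !mulrA.
apply: cvgD; last exact: cvg_flow_coef.
by apply: cvgM; [exact: cvg_cst|exact: cvg_flow_coef].
Qed.

Lemma flow_coord_sum i t (I : Type) (s : seq I) (a : I -> R) (f : I -> V) :
  flow_coord i t (\sum_(k <- s) a k *: f k) = \sum_(k <- s) a k * flow_coord i t (f k).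
Proof.
have z : flow_coord i t 0 = 0.
  by have := flow_coord_linear i t (-1) 0 0; rewrite scaler0 addr0 mulN1r addNr.
by elim: s => [|k s IH]; rewrite ?big_nil// !big_cons flow_coord_linear IH.
Qed.

Lemma flow0 x : flow 0 x = x.
Proof. by rewrite [RHS]c_span; apply: eq_bigr => i _; rewrite flow_coord0. Qed.

Lemma cvg_flow t x :
  series (fun k => (k`!%:R : R)^-1 *: iter k (fun y => t *: N y) x) @ \oo --> flow t x.
Proof.
have -> : series (fun k => (k`!%:R : R)^-1 *: iter k (fun y => t *: N y) x) =
  (fun k => \sum_(i < n) pseries (flow_coef i x) t k *: e i).
  apply/funext => k; rewrite [LHS]c_span; apply: eq_bigr => i _; congr (_ *: _).
  rewrite /series /= linear_sum /pseries /series /=; apply: eq_bigr => j _.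
  have -> : iter j (fun y => t *: N y) x = t ^+ j *: iter j N x.
    elim: j => [|j IH]; first by rewrite expr0 scale1r.
    by rewrite iterS IH linearZ /= scalerA -exprS.
  rewrite !linearZ /flow_coef /= -[_ *: _]/(_ * _) -[_ *: _]/(_ * _).
  by rewrite mulrC [RHS]mulrC mulrA.
apply: cvg_big => [|i _]; first exact: add_continuous.
by apply: cvgZr_tmp; exact: cvg_flow_coef.
Qed.

Arguments cvg_flow t x : clear implicits.

Lemma expop_flow t x : expop (fun y => t *: N y) x = flow t x.
Proof. by apply/cvg_lim; [exact: norm_hausdorff|exact: cvg_flow]. Qed.

Lemma flow_comm t x : flow t (N x) = N (flow t x).
Proof.
have H := cvg_flow t (N x).
rewrite -(cvg_lim (@norm_hausdorff _ V) H).
apply/cvg_lim; first exact: norm_hausdorff.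
have -> : series (fun k => (k`!%:R : R)^-1 *: iter k (fun y => t *: N y) (N x)) =
  N \o series (fun k => (k`!%:R : R)^-1 *: iter k (fun y => t *: N y) x).
  apply/funext => k; rewrite /series /= linear_sum; apply: eq_bigr => j _.
  rewrite linearZ; congr (_ *: _).
  by elim: j => //= j ->; rewrite linearZ.
exact: (cvg_comp _ _ (cvg_flow t x) (@N_cont (flow t x))).
Qed.

Lemma is_derive_flow x (t : R) : is_derive t 1 (fun s => flow s x) (N (flow t x)).
Proof.
rewrite -flow_comm.
have -> : (fun s => flow s x) = \sum_(i < n) (fun s => flow_coord i s x *: e i).
  by apply/funext => s; rewrite fct_sumE.
apply: is_derive_sum => i.
have [dF vF] := is_derive_flow_coord i x t.
have dF' : differentiable (fun s => flow_coord i s x) t by exact/derivable1_diffP.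
apply: DeriveDef.
  by apply/derivable1_diffP; exact: differentiableZl.
by rewrite deriveE ?diffZl -?deriveE ?vF//; exact: differentiableZl.
Qed.

(** Uniqueness for z' = N z comes from transporting back by the flow: the curve s |-> flow (t - s)
    (p (flow s x)) has zero derivative. It starts at flow t (p x) and reaches p (flow t x) at s = t.
    Coordinates reduce the product rule to scalar functions. *)
Lemma flow_equivariant (p : V -> V) : (forall x, differentiable p x) ->
  (forall x, 'd p x (N x) = N (p x)) -> forall t x, p (flow t x) = flow t (p x).
Proof.
move=> dp pN t x.
have dz (s : R) : is_derive s 1 (fun s => p (flow s x)) (N (p (flow s x))).
  have [dfl vfl] := is_derive_flow x s.
  have dfl' : differentiable (fun s => flow s x) s by exact/derivable1_diffP.
  have vfl' : 'd (fun s => flow s x) s 1 = N (flow s x) by rewrite -deriveE.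
  apply: DeriveDef; first by apply/derivable1_diffP; exact: differentiable_comp.
  rewrite deriveE; last exact: differentiable_comp.
  by rewrite (diff_comp (f := fun s => flow s x) (g := p))//= vfl' pN.
have dcz i (s : R) :
    is_derive s 1 (fun s => c i (p (flow s x)) : R) (c i (N (p (flow s x)))).
  have [dfl vfl] := dz s.
  have dfl' : differentiable (fun s => p (flow s x)) s by exact/derivable1_diffP.
  have vfl' : 'd (fun s => p (flow s x)) s 1 = N (p (flow s x)) by rewrite -deriveE.
  have dc y : differentiable (c i) y by exact: linear_differentiable.
  apply: DeriveDef; first by apply/derivable1_diffP; exact: differentiable_comp.
  rewrite deriveE; last exact: differentiable_comp.
  by rewrite (diff_comp (f := fun s => p (flow s x)) (g := c i))//= vfl' diff_lin.
have du j y (s : R) :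
    is_derive s 1 (fun s => flow_coord j (t - s) y) (- flow_coord j (t - s) (N y)).
  rewrite -mulrN1.
  apply: (@is_derive1_comp _ (fun s => flow_coord j s y) (fun s => t - s)).
    exact: is_derive_flow_coord.
  have -> : (fun s : R => t - s) = cst t - id by [].
  by rewrite -[-1]sub0r; exact: is_deriveB.
have key j : flow_coord j t (p x) = c j (p (flow t x)).
  (* [f s] is the j-th coordinate of [flow (t - s) (p (flow s x))]. *)
  pose f (s : R) := \sum_(i < n) (c i (p (flow s x)) : R) * flow_coord j (t - s) (e i).
  have df (s : R) : is_derive s 1 f 0.
    have -> : f = \sum_(i < n) ((fun s => c i (p (flow s x)) : R) *
       (fun s => flow_coord j (t - s) (e i))).
      by apply/funext => r; rewrite fct_sumE.
    have dS := is_derive_sum (fun i => is_deriveM (dcz i s) (du j (e i) s)).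
    apply: (is_derive_eq dS).
    (* The two halves recombine into the j-th coordinate of flow (t - s) at N (p (flow s x)), with
       opposite signs. *)
    rewrite big_split /=.
    under eq_bigr do rewrite -[_ *: _]/(_ * _) mulrN.
    rewrite sumrN -flow_coord_sum.
    under [X in _ + X]eq_bigr do rewrite -[_ *: _]/(_ * _) mulrC.
    rewrite -flow_coord_sum -c_span.
    have -> : \sum_(k < n) c k (p (flow s x)) *: N (e k) = N (p (flow s x)).
      rewrite [in RHS](c_span (p (flow s x))) linear_sum.
      by apply: eq_bigr => k _; rewrite linearZ.
    by rewrite addNr.
  have := is_derive_0_is_cst 0 t df; rewrite /f subr0 subrr flow0.
  rewrite -flow_coord_sum -c_span => ->.
  by rewrite -flow_coord_sum -c_span flow_coord0.
by rewrite [LHS]c_span; apply: eq_bigr => j _; rewrite key.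
Qed.

(** Equivariance passes to the closure: p is continuous at A x, and one bound in operator norm
    controls flow s - A at both x and p x. *)
Lemma exp_closure_equivariant (p : V -> V) : (forall x, differentiable p x) ->
  (forall x, 'd p x (N x) = N (p x)) ->
  forall A, exp_closure N A -> forall x, p (A x) = A (p x).
Proof.
move=> dp pN A [_ HA] x; apply/eqP; rewrite -subr_eq0 -normr_le0.
apply/ler_addgt0Pr => eps eps0; rewrite add0r.
have cp : {for A x, continuous p} by exact/differentiable_continuous.
have /cvgrPdist_le/(_ (eps / 2)) := cp; rewrite divr_gt0// => /(_ isT).
move=> /nbhs_ballP[d /= d0 Hd].
(* M exceeds both norms that multiply the operator bound; the summand 1 makes it positive. *)
pose M := 1 + `|x| + `|p x|.
have M0 : 0 < M by rewrite /M -addrA ltr_pwDl.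
have xM : `|x| < M by rewrite /M -addrA addrCA ltrDl ltr_pwDl.
have pM : `|p x| <= M by rewrite /M lerDr.
have [|s Hs] := HA (Num.min (d / M) (eps / 2 / M)).
  by rewrite lt_min !divr_gt0.
have {}Hs y : `|flow s y - A y| <= Num.min (d / M) (eps / 2 / M) * `|y|.
  by rewrite -expop_flow.
have h1 : `|p (A x) - p (flow s x)| <= eps / 2.
  apply: Hd; rewrite -ball_normE /= distrC; apply: le_lt_trans (Hs x) _.
  apply: (@le_lt_trans _ _ (d / M * `|x|)); first by rewrite ler_wpM2r// ge_min lexx.
  by rewrite mulrAC ltr_pdivrMr// ltr_pM2l.
have h2 : `|flow s (p x) - A (p x)| <= eps / 2.
  apply: le_trans (Hs _) _.
  apply: (@le_trans _ _ (eps / 2 / M * `|p x|)).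
    by rewrite ler_wpM2r// ge_min lexx orbT.
  by rewrite mulrAC ler_pdivrMr// ler_pM2l// divr_gt0.
rewrite (splitr eps) -(subrK (p (flow s x)) (p (A x))) -addrA.
apply: le_trans (ler_normD _ _) _; apply: lerD => //.
by rewrite (flow_equivariant dp pN).
Qed.

End LinearFlow.

(** * The tangent space to the orbit *)

Section TangentOrbit.
Variables (R : realType) (V : normedModType R).

Lemma homogZ l (a : R) (p : V -> V) : homog l p -> homog l (fun x => a *: p x).
Proof.
move=> [m [b [v ->]]]; exists m, b, (fun i => a *: v i); apply/funext => x.
by rewrite scaler_sumr; apply: eq_bigr => i _; rewrite !scalerA mulrC.
Qed.

Lemma homog0 l : homog l (fun=> 0 : V).
Proof.
have no (i : 'I_0) : False by case: i.
exists 0, (fun i _ => False_rect _ (no i)), (fun=> 0).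
by apply/funext => x; rewrite big_ord0.
Qed.

Variables (n : nat) (e : 'I_n -> V) (c : 'I_n -> {linear V -> R^o}).
Hypothesis c_le : forall i v, `|c i v| <= `|v|.
Hypothesis c_span : forall v, v = \sum_(i < n) c i v *: e i.
Hypothesis c_dual : forall i j, c i (e j) = (i == j)%:R.

(** In coordinates f is u |-> u M on row vectors, and a square matrix with zero kernel is
    invertible. It supplies the preimage that [inv_at] chooses. *)
Lemma findim_inj_surj (f : {linear V -> V}) : (forall v, f v = 0 -> v = 0) ->
  forall w, exists v, f v = w.
Proof.
move=> f0 w; pose M : 'M[R]_n := \matrix_(i, j) c j (f (e i)).
pose vec (u : 'rV[R]_n) := \sum_(i < n) u 0 i *: e i.
have cvec u j : c j (vec u) = u 0 j.
  rewrite linear_sum (bigD1 j)//= big1 ?addr0 => [|i ij].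
    by rewrite linearZ /= c_dual eqxx -[_ *: _]/(_ * _) mulr1.
  by rewrite linearZ /= c_dual eq_sym (negbTE ij) -[_ *: _]/(_ * _) mulr0.
have fvec u : f (vec u) = vec (u *m M).
  rewrite [LHS]c_span; apply: eq_bigr => j _; congr (_ *: _).
  rewrite mxE !linear_sum; apply: eq_bigr => i _.
  by rewrite !linearZ /= mxE.
have Mu : M \in unitmx.
  rewrite -row_free_unit -kermx_eq0 -submx0; apply/row_subP => i.
  have : row i (kermx M) *m M = 0 by apply: sub_kermxP; exact: row_sub.
  set u := row i _ => uM.
  have vu : vec u = 0.
    by apply: f0; rewrite fvec uM /vec big1// => j _; rewrite mxE scale0r.
  by rewrite submx0; apply/eqP/rowP => j; rewrite -cvec vu linear0 mxE.
exists (vec ((\row_j c j w) *m invmx M)); rewrite fvec mulmxKV//.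
by rewrite [RHS]c_span; apply: eq_bigr => j _; rewrite mxE.
Qed.

Variables (l : nat) (q : V -> V).
Hypothesis l_ge2 : (2 <= l)%N.
Hypothesis q_homog : homog l q.

Let q_diff x : differentiable q x := homog_differentiable c_le c_span x q_homog.

Lemma smooth_family_homog : smooth_family (fun (t : R) x => x + t *: q x).
Proof.
split=> [||x]; last by rewrite scale0r addr0.
  (* The sum over 2 <= m < l.+1 ends at m = l because [l_ge2] holds, and all other terms are
     zero. *)
  near=> t; exists l.+1, (fun m => if m == l then fun x => t *: q x else fun=> 0); split.
    move=> m; case: eqP => [->|_]; [exact: homogZ|exact: homog0].
  apply/funext => x; congr (_ + _).
  rewrite big_nat_recr//= eqxx big1_seq ?add0r// => i /andP[_].
  by rewrite mem_index_iota => /andP[_ il]; rewrite ltn_eqF.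
have lfst : linear (fun p : V * R^o => p.1) by [].
have lsnd : linear (fun p : V * R^o => p.2) by [].
pose fstl : {linear (V * R^o)%type -> V} :=
  HB.pack (fun p : V * R^o => p.1) (GRing.isLinear.Build _ _ _ _ _ lfst).
pose sndl : {linear (V * R^o)%type -> R^o} :=
  HB.pack (fun p : V * R^o => p.2) (GRing.isLinear.Build _ _ _ _ _ lsnd).
have sfst : smooth_near (0 : (V * R^o)%type) fstl.
  by apply: smooth_near_lin => p; exact: cvg_fst.
have ssnd : smooth_near (0 : (V * R^o)%type) sndl.
  by apply: smooth_near_lin => p; exact: cvg_snd.
apply: smooth_nearD; first exact: sfst.
apply: smooth_nearZ; first exact: ssnd.
have [m [a [v ->]]] := q_homog.
apply: smooth_near_sum => i _.
apply: (@smooth_nearZ _ _ _ _ (fun p : V * R^o => \prod_(j < l) (a i j p.1 : R) : R^o));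
  last exact: smooth_near_cst.
apply: (@smooth_near_prod _ _ _ _ _ _ (fun j (p : V * R^o) => a i j p.1)) => j _.
apply: (smooth_near_comp_lin (g := a i j : {linear V -> R^o}) _ sfst).
exact: (@findim_continuous R V n e c c_le c_span).
Unshelve. all: by end_near. Qed.

Lemma diff_near_identity (t : R) x :
  'd (fun x => x + t *: q x) x = (fun v => v + t *: 'd q x v) :> (V -> V).
Proof.
have [dZ vZ] := diff_scaleC t (q_diff x).
have di : differentiable (id : V -> V) x by exact: ex_diff.
have -> : (fun x => x + t *: q x) = id + (fun x => t *: q x) by [].
rewrite (diffD di dZ); apply/funext => v.
change ('d (id : V -> V) x v + 'd (fun x => t *: q x) x v = v + t *: 'd q x v).
by rewrite vZ diff_val.
Qed.

(** With D = 'd q x and H t = h (x + t q x), the transformed field y solves y + t D y = H. Hence z =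
    y u - y 0 satisfies z = (H u - H 0) - u D z - u D (y 0). A crude bound shows that z is small,
    which makes u D z negligible and gives the derivative H'(0) - D (h x). *)
Lemma is_derive_change_coord (h : V -> V) x : differentiable h x ->
  is_derive (0 : R^o) (1 : R^o)
    (fun t : R^o => change_coord (fun y => y + (t : R) *: q y) h x)
    ('d h x (q x) - 'd q x (h x)).
Proof.
move=> dh; pose D := 'd q x.
have cD : continuous D by exact: (@findim_continuous R V n e c c_le c_span).
have [K K0 HK] := linear_lipschitz cD.
pose y (t : R^o) := change_coord (fun y => y + (t : R) *: q y) h x.
pose H (t : R^o) := h (x + (t : R) *: q x).
(* For such t the map t D at most halves norms, so 1 + t D is injective, hence onto, and [get]
   returns a true solution. *)
have yE (t : R) : `|t| * K <= 1 / 2 -> y t + t *: D (y t) = H t.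
  move=> tK; rewrite /y /change_coord /inv_at.
  set P := [set z | _].
  have [z Pz] : exists z, P z.
    apply: (@findim_inj_surj ('d (fun y => y + t *: q y) x)) => v.
    rewrite diff_near_identity => /eqP; rewrite addr_eq0 => /eqP vE.
    apply/eqP; rewrite -normr_le0; have : `|v| <= 1 / 2 * `|v|.
      rewrite {1}vE normrN normrZ; apply: le_trans (ler_wpM2r (normr_ge0 v) tK).
      by rewrite -mulrA ler_wpM2l.
    rewrite -subr_le0 -{1}[`|v|]mul1r -mulrBl pmulr_rle0//.
    by rewrite subr_gt0 mul1r invf_lt1// ltr1n.
  have : P (get P) by apply: getPex; exists z.
  by rewrite {1}/P /= diff_near_identity.
have y0 : y 0 = H 0.
  by rewrite -(yE 0) ?normr0 ?mul0r ?divr_ge0// scale0r addr0.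
have H0 : H 0 = h x by rewrite /H scale0r addr0.
have dH : is_derive (0 : R^o) (1 : R^o) H ('d h x (q x)).
  have := @is_derive_line R V V h x (q x) 0; rewrite scale0r addr0; exact.
have dH' : differentiable H 0 by apply/derivable1_diffP; have [] := dH.
have vH (u : R^o) : 'd H 0 u = (u : R) *: 'd h x (q x).
  have := linearZ_LR ('d H 0) (u : R) (1 : R^o).
  rewrite -[X in 'd H 0 X]/((u : R) * 1) mulr1 => ->.
  by rewrite -deriveE//; have [_ ->] := dH.
have llin : linear (fun u : R^o => (u : R) *: ('d h x (q x) - D (h x))).
  by move=> a u v; rewrite scalerDl scalerA.
pose dy : {linear R^o -> V} := HB.pack
  (fun u : R^o => (u : R) *: ('d h x (q x) - D (h x)))
  (GRing.isLinear.Build R R^o V _ _ llin).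
have [|eps eps0|dfy vdy] := @diff_eps R R^o V y dy 0.
- by move=> u; apply: cvgZr_tmp; exact: cvg_id.
- have cH : {for (0 : R^o), continuous H} by exact: differentiable_continuous.
  have e2 : 0 < eps / 2 by exact: divr_gt0.
  (* Once z has norm at most d, the term u D z costs at most eps / 2 times the norm of u. *)
  pose d := eps / 2 / K.
  have d0 : 0 < d by rewrite !divr_gt0.
  (* The added 1 makes this a legitimate divisor even if y 0 = 0. *)
  have M0 : 0 < K * `|y 0| + 1 by rewrite ltr_wpDl// mulr_ge0// ltW.
  near=> u.
  have uK : `|u| * K <= 1 / 2.
    rewrite -ler_pdivlMr//; near: u; apply/nbhs_ballP; exists (1 / 2 / K) => /=.
      by rewrite !divr_gt0.
    by move=> z; rewrite -ball_normE /= sub0r normrN => /ltW.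
  have Hu : `|H u - H 0| <= d / 4.
    rewrite distrC; near: u; move/cvgrPdist_le: cH; apply; exact: divr_gt0.
  have uy : `|u| * (K * `|y 0|) <= d / 4.
    apply: (@le_trans _ _ (`|u| * (K * `|y 0| + 1))).
      by rewrite ler_wpM2l// lerDl.
    rewrite -ler_pdivlMr//; near: u; apply/nbhs_ballP.
    exists (d / 4 / (K * `|y 0| + 1)) => /=; first by rewrite !divr_gt0.
    by move=> z; rewrite -ball_normE /= sub0r normrN => /ltW.
  have dHu : `|H (0 + u) - H 0 - 'd H 0 u| <= eps / 2 * `|u|.
    by near: u; exact: (@diff_epsP _ _ _ H 0 dH' _ e2).
  have E := yE u uK; set z := y u - y 0.
  have zE : z = (H u - H 0) - u *: D z - u *: D (y 0).
    rewrite -addrA -opprD -scalerDr -linearD /z subrK -E y0.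
    by rewrite [RHS]addrAC addrK.
  have zd : `|z| <= d.
    (* The middle term is u D z, absorbed by the left side; the outer ones bound H u - H 0 and u D
       (y 0). *)
    have : `|z| <= d / 4 + 1 / 2 * `|z| + d / 4.
      rewrite {1}zE; apply: le_trans (ler_normB _ _) _; apply: lerD.
        apply: le_trans (ler_normB _ _) _; apply: lerD => //.
        rewrite normrZ; apply: le_trans (ler_wpM2r (normr_ge0 z) uK).
        by rewrite -mulrA ler_wpM2l.
      by rewrite normrZ; apply: le_trans uy; rewrite ler_wpM2l.
    by move: (`|z|) => r; lra.
  rewrite add0r in dHu *.
  have -> : y u - y 0 - dy u = (H u - H 0 - 'd H 0 u) - u *: D z.
    rewrite -/z vH [in LHS]zE /dy /= scalerBr -H0 -y0 opprB.
    by rewrite addrA subrK addrAC.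
  apply: le_trans (ler_normB _ _) _; rewrite [X in _ <= X * _](splitr eps) mulrDl.
  apply: lerD => //; rewrite normrZ mulrC ler_wpM2r//.
  apply: le_trans (HK z) _; rewrite -ler_pdivlMl// mulrC; exact: zd.
apply: DeriveDef; first exact: diff_derivable.
by rewrite deriveE// vdy /dy /= scale1r.
Unshelve. all: by end_near. Qed.

Lemma tangent_orbit_homog (h : V -> V) : smooth_near 0 h ->
  tangent_orbit h (fun x => 'd h x (q x) - 'd q x (h x)).
Proof.
move=> sh; exists (fun t x => x + t *: q x); split; first exact: smooth_family_homog.
apply: filterS (smooth_near_differentiable sh) => x dh.
exact: is_derive_change_coord.
Qed.

End TangentOrbit.

Lemma count_index_enum (T : finType) (P : pred T) : count P (index_enum T) = #|P|.
Proof.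
by rewrite /index_enum; case: index_enum_key; rewrite /= cardE /enum_mem size_filter.
Qed.

(** * Orders of the errors made by linearising h in the tangent vector *)

Section Remainder.
Variables (R : realType) (V : normedModType R).
Variables (n : nat) (e : 'I_n -> V) (c : 'I_n -> {linear V -> R^o}).
Hypothesis c_le : forall i v, `|c i v| <= `|v|.
Hypothesis c_span : forall v, v = \sum_(i < n) c i v *: e i.

Let lin_cont (W : normedModType R) (f : {linear V -> W}) : continuous f :=
  @findim_continuous R V n e c c_le c_span W f.

Lemma homog_smooth l (p : V -> V) : homog l p -> smooth_near 0 p.
Proof.
move=> [m [a [v ->]]]; apply: smooth_near_sum => i _.
apply: (@smooth_nearZ _ _ _ _ (fun x => \prod_(j < l) (a i j x : R) : R^o));
  last exact: smooth_near_cst.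
apply: (@smooth_near_prod _ _ _ _ _ _ (fun j => a i j)) => j _.
by apply: (@smooth_near_lin _ _ _ _ (a i j : {linear V -> R^o})); exact: lin_cont.
Qed.

Lemma homog_at0 l (p : V -> V) : (0 < l)%N -> homog l p -> p 0 = 0.
Proof.
case: l => // l _ [m [a [v ->]]]; rewrite big1// => i _.
by rewrite big_ord_recl linear0 mul0r scale0r.
Qed.

(** The l linear forms of each monomial of q give order l; 'd h x - 'd h 0 vanishes at 0 and gives
    one more. *)
Lemma Mpow_diff_homog l (h q : V -> V) : smooth_near 0 h -> homog l q ->
  Mpow V l.+1 (fun x => 'd h x (q x) - 'd h 0 (q x)).
Proof.
move=> sh /(homog_tensor c_span)[w ->].
apply: (@Mpow_ext _ _ _ (fun x => \sum_(k : tensor_index n l)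
    (\prod_(j < l) (c (k.1 j) x : R)) *: (w k *: ('d h x (e k.2) - 'd h 0 (e k.2))))).
  move=> x; rewrite /tensor_poly (linear_sum ('d h x)) (linear_sum ('d h 0)) -sumrB.
  apply: eq_bigr => k _; rewrite /monomial !linearZ /= !scalerBr !scalerA.
  by rewrite scalerN mulrC.
apply: Mpow_sum => k _.
have -> : l.+1 = (count predT (index_enum 'I_l) + 1)%N.
  by rewrite count_index_enum card_ord addn1.
apply: Mpow_prodZ; first by move=> j _; exact: (linear_max_ideal c_le c_span).
apply: (Mpow_smoothZ (b := fun=> w k)); first exact: smooth_near_cst.
apply: (vanishing_Mpow1 c_le c_span); last exact: subrr.
apply: (@smooth_nearD _ _ _ _ _ (fun=> - 'd h 0 (e k.2))); last exact: smooth_near_cst.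
exact: smooth_near_diff.
Qed.

(** A derivative of q keeps l - 1 linear forms, and its argument h - 'd h 0 has order two. *)
Lemma Mpow_homog_diff l (h q : V -> V) : smooth_near 0 h -> h 0 = 0 -> homog l q ->
  Mpow V l.+1 (fun x => 'd q x (h x) - 'd q x ('d h 0 x)).
Proof.
move=> sh h0 /(homog_tensor c_span)[w ->].
have dh : differentiable h 0 by exact: nbhs_singleton (smooth_near_differentiable sh).
pose a i : V -> R^o := fun x => c i (h x).
have ha i : max_ideal (a i).
  by split; [apply: smooth_near_comp_lin => //; exact: lin_cont|rewrite /a h0 linear0].
have da i x : 'd (a i) 0 x = c i ('d h 0 x).
  have dc : differentiable (c i) (h 0) by apply: linear_differentiable; exact: lin_cont.
  by rewrite (diff_comp (f := h) (g := c i) dh dc) /= diff_lin//; exact: lin_cont.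
apply: (@Mpow_ext _ _ _ (fun x => \sum_(k : tensor_index n l) \sum_(m < l)
    (a (k.1 m) x - 'd (a (k.1 m)) 0 x) *: ((\prod_(j < l | j != m) (c (k.1 j) x : R)) *: (w k *: e k.2)))).
  move=> x; rewrite -linearB (diff_tensor_poly e c_le w x).2; apply: eq_bigr => k _.
  rewrite (diff_monomial e c_le k x).2 scaler_suml scaler_sumr; apply: eq_bigr => m _.
  by rewrite da -linearB !scalerA; rewrite [in RHS]mulrC -mulrA.
apply: Mpow_sum => k _; apply: Mpow_sum => m _.
(* The existence of m in 'I_l makes l positive, so that (l - 1) + 2 is l + 1. *)
have -> : l.+1 = (count (predC1 m) (index_enum 'I_l) + 0).+2.
  by rewrite count_index_enum cardC1 card_ord addn0 (ltn_predK (ltn_ord m)).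
apply: (Mpow_order2Z c_le c_span) => //.
apply: Mpow_prodZ; first by move=> j _; exact: (linear_max_ideal c_le c_span).
by apply: smooth_Mpow0; exact: smooth_near_cst.
Qed.

End Remainder.

(** * Assembly of the splitting, the tangent vector and the remainders *)

Theorem theorem3p3 (R : realType) (V : normedModType R)
  (ip : {dot V for idfun}) (ip_norm : forall x : V, `|x| ^+ 2 = ip x x)
  (V_fin : finite_dimensional V)
  (k : nat) (k_ge1 : (1 <= k)%N)
  (h : V -> V) (h_jet : jets k h)
  (Lt : {linear V -> V}) (Lt_adj : is_adjoint ip ('d h (0 : V)) Lt) :
  Mpow V k.+1 `<=`
    sumset (sumset (homog_equivariant k.+1 (exp_closure Lt)) (tangent_orbit h))
           (Mpow V k.+2).
Proof.
move=> f hf.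
have [n [e [c [c_le c_span c_dual c_ip]]]] := coordinates_exist ip_norm V_fin.
have [hs h0] : smooth_near 0 h /\ h 0 = 0.
  have [qs [qh ->]] := h_jet; split.
    by apply: smooth_near_sum => l _; exact: (homog_smooth c_le c_span (qh l)).
  rewrite big1_seq// => l /andP[_]; rewrite mem_index_iota => /andP[l0 _].
  exact: (homog_at0 l0 (qh l)).
have adj i r : c i ('d h 0 (e r)) = c r (Lt (e i)).
  by rewrite !c_ip Lt_adj (ipC ip).
have [p hp fp] := Mpow_leading_term c_le c_span hf.
have [q0 [s [hq0 hsg pE sL]]] := homog_splitting c_le c_span adj hp.
have dq0 x : differentiable q0 x := homog_differentiable c_le c_span x hq0.
have ds x : differentiable s x := homog_differentiable c_le c_span x hsg.
(* The family x + t q x contributes - ad_L q to leading order, so the sign is reversed to obtain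
   ad_L q0. *)
pose q x := -1 *: q0 x.
have hq : homog k.+1 q by exact: homogZ.
have dqE x v : 'd q x v = - 'd q0 x v.
  by rewrite /q (diff_scaleC (-1) (dq0 x)).2 scaleN1r.
pose g x := 'd h x (q x) - 'd q x (h x).
exists (s \+ g).
  exists s; last first.
    (* Here [k_ge1] gives degree k.+1 >= 2, which places x + t q x in [diffeos]. *)
    by exists g => //; exact: (tangent_orbit_homog c_le c_span c_dual (l := k.+1)).
  have sN y : 'd s y (Lt y) = Lt (s y).
    by apply/eqP; rewrite -subr_eq0; apply/eqP; exact: sL.
  by split=> // A SA x; exact: (exp_closure_equivariant c_le c_span ds sN SA).
exists (fun x => f x - (s x + g x)); last by apply/funext => x /=; rewrite addrC subrK.
have h1 := Mpow_diff_homog c_le c_span hs hq.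
have h2 := Mpow_homog_diff c_le c_span hs h0 hq.
have neg j (F : V -> V) : Mpow V j F -> Mpow V j (fun x => -1 *: F x).
  by apply: (Mpow_smoothZ (b := fun=> -1)); exact: smooth_near_cst.
(* Writing L for 'd h 0, since p = ad_L q0 + s, the remainder f - (s + g) is (f - p) - ('d h x (q x)
   - L (q x)) + ('d q x (h x) - 'd q x (L x)). *)
apply: Mpow_ext (MpowD fp (MpowD (neg _ _ h1) h2)) => x.
rewrite pE /g /bracket !scaleN1r.
have -> : 'd q0 x ('d h 0 x) = - 'd q x ('d h 0 x) by rewrite dqE opprK.
have -> : 'd h 0 (q0 x) = - 'd h 0 (q x) by rewrite /q scaleN1r linearN opprK.
move: (f x) (s x) ('d q x ('d h 0 x)) ('d h 0 (q x)) ('d h x (q x)) ('d q x (h x)).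
move=> F S a b A B.
rewrite !opprB !opprD !opprK.
rewrite -addrA; congr (_ + _); rewrite (addrC (a - b)) -addrA; congr (_ + _).
by rewrite -(addrA b (- A)) (addrA (a - b)) subrK addrCA (addrCA a) subrr addr0.
Qed.
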